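(* Let $K$ be a simplicial complex and let $\mathcal{U}$ be a good cover of $K$ by subcomplexes. Let $P_K$ denote the face poset of $K$ and $P_{N\mathcal{U}}$ the face poset of the nerve $N\mathcal{U}$. Let $\tilde{R} \subseteq P_K \times P_{N\mathcal{U}}$ be the covering relation, considered as a poset (with the order restricted from the product order). Then the projection maps $$P_K \leftarrow \tilde{R} \rightarrow P_{N\mathcal{U}}$$ induce homotopy equivalences $$\|\Delta P_K\| \xleftarrow{\simeq} \|\Delta \tilde{R}\| \xrightarrow{\simeq} \|\Delta P_{N\mathcal{U}}\|.$$
   Context: The face poset $P_K$ of a simplicial complex $K$ is the set of its (non-empty) simplices ordered by inclusion. For a poset $P$, the order complex $\Delta P$ is the abstract simplicial complex whose $k$-simplices are the chains $p_0 < \cdots < p_k$ in $P$; $\|\cdot\|$ denotes geometric realization. A cover $\mathcal{U}$ of $K$ by subcomplexes is good if every non-empty finite intersection of its elements is contractible. The nerve $N\mathcal{U}$ is the simplicial complex whose simplices are the non-empty finite subsets of $\mathcal{U}$ with non-empty common intersection. The covering relation is: $\sigma \tilde{R} \tau$ if and only if the simplex $\sigma$ of $K$ belongs to every cover element in $\tau$. The product order on $P \times Q$ is $(p,q) \le (p',q')$ iff $p \le p'$ and $q \le q'$. *)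

(* Defs.v *)
From HB Require Import structures.
From mathcomp Require Import all_boot all_order all_algebra.
From mathcomp Require Import finmap.
From mathcomp Require Import all_classical all_reals all_analysis.

Set Implicit Arguments.
Unset Strict Implicit.
Unset Printing Implicit Defensive.

Import Order.TTheory GRing.Theory Num.Theory.
Import numFieldNormedType.Exports.

Local Open Scope classical_set_scope.
Local Open Scope ring_scope.

(* Abstract simplicial complexes, possibly infinite, with simplices finite
   subsets of V. The empty set is not a simplex, and an element of V need not
   be a vertex. *)
Record scomplex (V : choiceType) := SComplex {
  simplex :> {fset V} -> Prop;
  simplex_neq0 : forall s, simplex s -> s != fset0;
  simplex_sub : forall s t, simplex s -> (t `<=` s)%fset -> t != fset0 ->
    simplex t }.

HB.instance Definition _ (V : choiceType) := gen_eqMixin (scomplex V).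
HB.instance Definition _ (V : choiceType) := gen_choiceMixin (scomplex V).

Fact face_display : Order.disp_t. Proof. exact: (Order.Disp tt tt). Qed.

Definition face_poset (V : choiceType) (K : scomplex V) : Type :=
  set_type (simplex K).

Section FacePoset.
Variables (V : choiceType) (K : scomplex V).
Local Notation P := (face_poset K).

HB.instance Definition _ := SubChoice.on P.

Definition face_le (s t : P) : bool := (val s `<=` val t)%fset.

Lemma face_le_refl : reflexive face_le.
Proof. by move=> s; exact: fsubset_refl. Qed.

Lemma face_le_anti : antisymmetric face_le.
Proof. by move=> s t st; apply/val_inj/eqP; rewrite eqEfsubset. Qed.

Lemma face_le_trans : transitive face_le.
Proof. by move=> t s u; exact: fsubset_trans. Qed.

HB.instance Definition _ :=
  Order.Le_isPOrder.Build face_display P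
    face_le_refl face_le_anti face_le_trans.

End FacePoset.

Section OrderComplex.
Variables (d : Order.disp_t) (P : porderType d).

Definition chain (s : {fset P}) : Prop :=
  {in s &, forall x y, (x >=< y)%O}.

Lemma chain_neq0 (s : {fset P}) : s != fset0 /\ chain s -> s != fset0.
Proof. by case. Qed.

Lemma chain_sub (s t : {fset P}) : s != fset0 /\ chain s ->
  (t `<=` s)%fset -> t != fset0 -> t != fset0 /\ chain t.
Proof.
by move=> [_ cs] /fsubsetP ts t0; split=> // x y /ts xs /ts ys; exact: cs.
Qed.

Definition order_complex : scomplex P :=
  @SComplex P [set s | s != fset0 /\ chain s] chain_neq0 chain_sub.

End OrderComplex.

(* Points of the geometric realization, in barycentric coordinates. *)
Definition realization_set (R : realType) (V : choiceType) (K : scomplex V) :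
    set {fsfun V -> R with 0} :=
  [set x : {fsfun V -> R with 0} | [/\ forall v, 0 <= x v,
               \sum_(v <- finsupp x) x v = 1 &
               K (finsupp x)]].

Arguments realization_set R {V} K : rename.

Definition realization (R : realType) (V : choiceType) (K : scomplex V) :
  Type := set_type (realization_set R K).

Section RealizationTopology.
Variables (R : realType) (V : choiceType) (K : scomplex V).
Local Notation X := (realization R K).

HB.instance Definition _ := SubChoice.on X.

Definition closed_cell (s : {fset V}) : set X :=
  [set x | (finsupp (val x) `<=` s)%fset].

(* The coherent (weak) topology: a set is open iff its intersection with each
   closed simplex s is open for the Euclidean topology of s, here given by the
   sup distance between barycentric coordinates. *)
Definition coherent_open (A : set X) : Prop :=
  forall s, K s -> forall x, (A `&` closed_cell s) x ->
    exists2 e : R, 0 < e &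
      forall y, closed_cell s y ->
        (forall v, `|val x v - val y v| < e) -> A y.

Lemma coherent_openT : coherent_open setT.
Proof. by move=> s _ x _; exists 1. Qed.

Lemma coherent_openI : setI_closed coherent_open.
Proof.
move=> A B oA oB s Ks x [[Ax Bx] sx].
have [e e0 eA] := oA _ Ks _ (conj Ax sx).
have [f f0 fB] := oB _ Ks _ (conj Bx sx).
exists (Num.min e f); first by rewrite lt_min e0 f0.
move=> y sy xy; split.
  by apply: eA => // v; have := xy v; rewrite lt_min => /andP[].
by apply: fB => // v; have := xy v; rewrite lt_min => /andP[].
Qed.

Lemma coherent_open_bigU (I : Type) (F : I -> set X) :
  (forall i, coherent_open (F i)) -> coherent_open (\bigcup_i F i).
Proof.
move=> oF s Ks x [[i _ Fx] sx]; have [e e0 eF] := oF i _ Ks _ (conj Fx sx).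
by exists e => // y sy xy; exists i => //; exact: eF.
Qed.

HB.instance Definition _ :=
  isOpenTopological.Build X
    coherent_openT coherent_openI coherent_open_bigU.

End RealizationTopology.

Definition simplicial (V W : choiceType) (K : scomplex V) (L : scomplex W)
    (f : V -> W) : Prop :=
  forall s, K s -> L (f @` s)%fset.

Section RealizationMap.
Variables (R : realType) (V W : choiceType).
Variables (K : scomplex V) (L : scomplex W) (f : V -> W).

(* Affine extension of f: the coordinate at w is the sum of the coordinates
   over the fibre of w. *)
Definition pushforward (x : {fsfun V -> R with 0}) : {fsfun W -> R with 0} :=
  [fsfun w in (f @` finsupp x)%fset =>
     \sum_(v <- finsupp x | f v == w) x v | 0].

Lemma pushforwardE (x : {fsfun V -> R with 0}) w :
  pushforward x w = \sum_(v <- finsupp x | f v == w) x v.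
Proof.
rewrite fsfunE; case: ifPn => // wx; rewrite big_seq_cond big1 // => v.
by case/andP=> vx /eqP fv; move: wx; rewrite -fv in_imfset.
Qed.

Lemma finsupp_pushforward (x : {fsfun V -> R with 0}) : (forall v, 0 <= x v) ->
  finsupp (pushforward x) = (f @` finsupp x)%fset.
Proof.
move=> x0; apply/fsetP => w; rewrite mem_finsupp pushforwardE.
apply/idP/imfsetP => [|[v /= vx ->]].
  apply: contraNP => nw; rewrite big_seq_cond big1 // => v /andP[vx /eqP fv].
  by case: nw; exists v.
have xv : 0 < x v by rewrite lt_neqAle x0 andbT eq_sym -mem_finsupp.
rewrite gt_eqF // big_mkcond (big_fsetD1 v) //= eqxx.
by rewrite ltr_wpDr // sumr_ge0 // => u _; case: ifP.
Qed.

Hypothesis fKL : simplicial K L f.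

Lemma realization_setP (x : realization R K) :
  pushforward (val x) \in realization_set R L.
Proof.
have /set_mem[x0 x1 Kx] := valP x; apply/mem_set; split.
- by move=> w; rewrite pushforwardE sumr_ge0.
- rewrite finsupp_pushforward // -[RHS]x1.
  under eq_bigr do rewrite pushforwardE.
  rewrite (exchange_big_dep xpredT) //= big_seq [RHS]big_seq.
  apply: eq_bigr => v vx; rewrite big_mkcond (big_fsetD1 (f v)) ?in_imfset //=.
  rewrite eqxx -big_mkcond big_seq_cond big1 ?addr0 // => w.
  by rewrite !inE => /andP[/andP[/negPf wf _]]; rewrite eq_sym wf.
- by rewrite finsupp_pushforward //; exact: fKL.
Qed.

Definition realization_map (x : realization R K) : realization R L :=
  exist _ (pushforward (val x)) (realization_setP x).

End RealizationMap.

Lemma nondecreasing_simplicial (d d' : Order.disp_t)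
    (P : porderType d) (Q : porderType d') (f : P -> Q) :
  {homo f : x y / (x <= y)%O} ->
  simplicial (order_complex P) (order_complex Q) f.
Proof.
move=> hf s [s0 cs]; split.
  have /fset0Pn[x xs] := s0; apply/fset0Pn; exists (f x).
  by apply/imfsetP; exists x.
move=> _ _ /imfsetP[x /= xs ->] /imfsetP[y /= ys ->].
by have /orP[/hf|/hf] := cs x y xs ys; rewrite /Order.comparable => ->;
  rewrite ?orbT.
Qed.

Definition order_realization_map (R : realType) (d d' : Order.disp_t)
    (P : porderType d) (Q : porderType d') (f : P -> Q)
    (hf : {homo f : x y / (x <= y)%O}) :
    realization R (order_complex P) -> realization R (order_complex Q) :=
  realization_map (nondecreasing_simplicial hf).

Arguments order_realization_map R {d d' P Q} f hf.

Definition homotopic (R : realType) (X Y : topologicalType) (f g : X -> Y) :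
    Prop :=
  exists H : X * R -> Y,
    [/\ {within [set: X] `*` `[0, 1], continuous H},
        forall x, H (x, 0) = f x &
        forall x, H (x, 1) = g x].

Definition homotopy_equivalence (R : realType) (X Y : topologicalType)
    (f : X -> Y) : Prop :=
  continuous f /\
  exists g : Y -> X,
    [/\ continuous g, homotopic R (g \o f) id & homotopic R (f \o g) id].

Definition contractible (R : realType) (X : topologicalType) : Prop :=
  exists x0 : X, homotopic R id (fun _ : X => x0).

Section Cover.
Variables (V : choiceType).
Implicit Types (K L : scomplex V) (U : set (scomplex V)).
Implicit Types (T : {fset scomplex V}).

Lemma inter_neq0 T (s : {fset V}) :
  (s != fset0 /\ forall L, L \in T -> L s) -> s != fset0.
Proof. by case. Qed.

Lemma inter_sub T (s t : {fset V}) :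
  (s != fset0 /\ forall L, L \in T -> L s) ->
  (t `<=` s)%fset -> t != fset0 ->
  t != fset0 /\ forall L, L \in T -> L t.
Proof.
by move=> [s0 Ts] ts t0; split=> // L /Ts Ls; exact: simplex_sub ts t0.
Qed.

(* The condition s != fset0 only matters when T is empty. *)
Definition inter_complex T : scomplex V :=
  @SComplex V [set s | s != fset0 /\ forall L, L \in T -> L s]
    (@inter_neq0 T) (@inter_sub T).

Definition is_cover K U : Prop :=
  (forall L, U L -> simplex L `<=` simplex K) /\
  simplex K `<=` \bigcup_(L in U) simplex L.

Definition good_cover (R : realType) K U : Prop :=
  is_cover K U /\
  forall T, T != fset0 -> (forall L, L \in T -> U L) ->
    simplex (inter_complex T) !=set0 ->
    contractible R (realization R (inter_complex T)).

Definition nerve_simplex U : set {fset scomplex V} :=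
  [set T | [/\ T != fset0, forall L, L \in T -> U L &
               simplex (inter_complex T) !=set0]].

Lemma nerve_neq0 U T : nerve_simplex U T -> T != fset0.
Proof. by case. Qed.

Lemma nerve_sub U T T' : nerve_simplex U T -> (T' `<=` T)%fset ->
  T' != fset0 -> nerve_simplex U T'.
Proof.
move=> [_ TU [s [s0 Ts]]] /fsubsetP T'T T'0; split=> //.
  by move=> L /T'T /TU.
by exists s; split=> // L /T'T /Ts.
Qed.

Definition nerve U : scomplex (scomplex V) :=
  @SComplex _ (nerve_simplex U) (@nerve_neq0 U) (@nerve_sub U).

Definition covering_relation K U :
    set (face_poset K *p face_poset (nerve U)) :=
  [set st | forall L, L \in val st.2 -> L (val st.1)].

End Cover.

Arguments covering_relation {V} K U : rename.

Fact covering_display : Order.disp_t. Proof. exact: (Order.Disp tt tt). Qed.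

Definition covering_poset (V : choiceType) (K : scomplex V)
  (U : set (scomplex V)) : Type := set_type (covering_relation K U).

Section CoveringPoset.
Variables (V : choiceType) (K : scomplex V) (U : set (scomplex V)).

HB.instance Definition _ := SubChoice.on (covering_poset K U).
HB.instance Definition _ :=
  [SubChoice_isSubPOrder of covering_poset K U by <: with covering_display].

Definition covering_fst (x : covering_poset K U) : face_poset K := (val x).1.
Definition covering_snd (x : covering_poset K U) : face_poset (nerve U) :=
  (val x).2.

Lemma covering_fst_le : {homo covering_fst : x y / (x <= y)%O}.
Proof. by move=> x y; rewrite leEsub => /andP[]. Qed.

Lemma covering_snd_le : {homo covering_snd : x y / (x <= y)%O}.
Proof. by move=> x y; rewrite leEsub => /andP[]. Qed.

End CoveringPoset.

(* Main.v *)
(** A monotone assignment of contractible subcomplexes C s of Y to the simplices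
    s of X is a carrier: a continuous map |X| -> |Y| sending each cell s into
    |C s| exists, by extension over one simplex after the other, and when X
    consists of chains of a poset any two such maps are homotopic, because the
    prism over X, triangulated along the chains, has the same kind of carrier.

    For a monotone f : P -> Q with contractible fibres {p | q <= f p}, sending a
    chain c to the chains in {p | min c <= f p} is a carrier, and the map it
    carries is a homotopy inverse of |f|. This is Quillen's fibre lemma.

    In the covering relation, the fibre over s retracts to a cone by the zigzag
    (s', t) >= (s, t) <= (s, t + {U0}) >= (s, {U0}), where U0 is a cover element
    containing s. The fibre over t is homotopy dominated by the intersection L
    of the elements of t: choosing a vertex of each simplex is a simplicial map
    to L, and a map back is carried by s |-> {(s', t) | s' <= s}; no comparison
    of L with its barycentric subdivision is needed. *)

Require Import Defs.
From mathcomp Require Import all_boot all_order all_algebra.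
From mathcomp Require Import finmap lra.
From mathcomp Require Import all_classical all_reals all_analysis.

Set Implicit Arguments.
Unset Strict Implicit.
Unset Printing Implicit Defensive.

Import Order.TTheory GRing.Theory Num.Theory.
Import numFieldNormedType.Exports.

Local Open Scope classical_set_scope.
Local Open Scope ring_scope.

(** * Finite-dimensional neighbourhoods in the coherent topology *)

Section CellFilter.
Variables (R : realType) (V : choiceType) (X : scomplex V).
Implicit Types (W s : {fset V}) (x y : realization R X).
Local Notation bc y := (val (y : realization R X)).

(** The trace on the cell of [W] of the sup-distance neighbourhoods of [x]. It is only a [Filter]:
    it contains the empty set when [x] lies off that cell. *)
Definition cell_nbhs W x : set_system (realization R X) :=
  [set A | exists2 e : R, 0 < e & forall y, closed_cell W y ->
     (forall v, `|val x v - val y v| < e) -> A y].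

Global Instance cell_nbhs_filter W x : Filter (cell_nbhs W x).
Proof.
split; first by exists 1.
- move=> A B [e e0 eA] [f f0 fB]; exists (Num.min e f).
    by rewrite lt_min e0 f0.
  move=> y Wy xy; split.
    by apply: eA => // v; have := xy v; rewrite lt_min => /andP[].
  by apply: fB => // v; have := xy v; rewrite lt_min => /andP[].
- by move=> A B AB [e e0 eA]; exists e => // y Wy xy; apply/AB/eA.
Qed.

Lemma realizationP x : [/\ forall v, 0 <= val x v,
  \sum_(v <- finsupp (val x)) val x v = 1 & X (finsupp (val x))].
Proof. exact: set_mem (valP x). Qed.

Lemma coord_ge0 x v : 0 <= val x v.
Proof. by have [] := realizationP x. Qed.

Lemma supp_simplex x : X (finsupp (val x)).
Proof. by have [] := realizationP x. Qed.

Lemma coord_gt0 x v : (0 < val x v) = (v \in finsupp (val x)).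
Proof. by rewrite lt0r coord_ge0 andbT mem_finsupp. Qed.

Lemma sum_coord x W : closed_cell W x -> \sum_(v <- W) val x v = 1.
Proof.
move=> Wx; have [_ <- _] := realizationP x.
by apply/esym/big_fset_incl => // v _; rewrite mem_finsupp negbK => /eqP.
Qed.

Lemma coord_le1 x v : val x v <= 1.
Proof.
have [vx|] := boolP (v \in finsupp (val x)); last first.
  by rewrite mem_finsupp negbK => /eqP->.
have [x0 <- _] := realizationP x; rewrite (big_fsetD1 v) //= lerDl.
by rewrite sumr_ge0.
Qed.

Lemma near_cell W x : \forall y \near cell_nbhs W x, closed_cell W y.
Proof. by exists 1. Qed.

Lemma near_coord W x (e : R) : 0 < e ->
  \forall y \near cell_nbhs W x, forall v, `|val x v - bc y v| < e.
Proof. by exists e. Qed.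

(** Finitely many positive coordinates stay positive under a small perturbation, so supports can
    only grow near [x]. *)
Lemma near_supp W x :
  \forall y \near cell_nbhs W x, (finsupp (val x) `<=` finsupp (bc y))%fset.
Proof.
have /fset0Pn[v0 v0x] := simplex_neq0 (supp_simplex x).
suff : forall l : seq V, {subset l <= finsupp (val x)} ->
    \forall y \near cell_nbhs W x, {subset l <= finsupp (bc y)}.
  by move=> /(_ _ (fun v vx => vx)); apply: filterS => y /fsubsetP.
elim=> [|v l IH] lx; first exact: nearW.
have vx : 0 < val x v by rewrite coord_gt0 lx ?mem_head.
have {}IH := IH (fun u ul => lx u (mem_behead (s := v :: l) ul)).
near=> y; have ly : {subset l <= finsupp (val y)} by near: y.
have /ltr_normlP[_] : `|val x v - val y v| < val x v.
  by near: y; apply: filterS (near_coord W x vx) => y; exact.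
move=> h u; rewrite inE => /orP[/eqP->|]; last exact: ly.
by rewrite -coord_gt0; lra.
Unshelve. all: by end_near. Qed.

(* A map continuous on each cell of A is continuous on their union, even when
   the finite vertex set W spans no simplex. *)
Lemma cell_nbhs_glue W x (A : set {fset V}) (B : set (realization R X)) :
  (forall s t, A s -> t != fset0 -> (t `<=` s)%fset -> A t) ->
  (forall s, A s -> closed_cell s x -> cell_nbhs s x B) ->
  cell_nbhs W x [set y | A (finsupp (val y)) -> B y].
Proof.
move=> Ad AB.
suff : forall l : seq {fset V},
    \forall y \near cell_nbhs W x, finsupp (bc y) \in l ->
      A (finsupp (val y)) -> B y.
  move=> /(_ (enum_fset (fpowerset W))) H.
  near=> y; apply: (near H y) => //.
  have Wy : closed_cell W y by near: y; exact: near_cell.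
  by have := Wy; rewrite /closed_cell /= -fpowersetE.
elim=> [|s l IH]; first exact: nearW.
(* If [s] is not in [A], or its cell misses [x], then by [near_supp] no nearby point has support [s]
   with [s] in [A]. *)
have [[As sx]|nAs] := pselect (A s /\ closed_cell s x); last first.
  near=> y; rewrite inE => /orP[/eqP ys|yl].
    rewrite ys => As; exfalso; apply: nAs; split=> //.
    by rewrite /closed_cell/= -ys; near: y; exact: near_supp.
  by move: yl; near: y; exact: IH.
have [e e0 eB] := AB _ As sx.
near=> y; rewrite inE => /orP[/eqP ys _|yl].
  apply: eB; first by rewrite /closed_cell/= ys fsubset_refl.
  by near: y; exact: near_coord.
by move: yl; near: y; exact: IH.
Unshelve. all: by end_near. Qed.

Lemma coherent_openP (A : set (realization R X)) :
  open A <-> forall s x, X s -> closed_cell s x -> A x -> cell_nbhs s x A.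
Proof.
have -> : open A = coherent_open A by [].
split=> [oA s x Xs sx Ax|oA s Xs x [Ax sx]]; last exact: oA.
exact: (oA _ Xs x (conj Ax sx)).
Qed.

(** On points supported in a finite vertex set the Euclidean topology is as fine as the coherent
    one, because only finitely many cells occur there. *)
Lemma cell_nbhs_cvg W x : cell_nbhs W x --> x.
Proof.
move=> A; rewrite /= nbhsE => -[B [oB Bx] BA].
suff : cell_nbhs W x [set y | X (finsupp (val y)) -> B y].
  by apply: filterS => y By; apply/BA/By/supp_simplex.
apply: cell_nbhs_glue => [s t Xs t0 ts|s Xs sx]; first exact: simplex_sub ts t0.
by apply: (iffLR (coherent_openP _)).
Qed.

Definition cont_on (T : topologicalType) (A : set {fset V})
    (g : realization R X -> T) :=
  forall s x, A s -> closed_cell s x -> g @ cell_nbhs s x --> g x.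

Section ContOn.
Variables (T : topologicalType) (A : set {fset V}) (g : realization R X -> T).
Hypothesis Ad : forall s t, A s -> t != fset0 -> (t `<=` s)%fset -> A t.
Hypothesis gA : cont_on A g.

Let D := [set y : realization R X | A (finsupp (val y))].

Lemma cont_on_within x : D x -> g @ within D (nbhs x) --> g x.
Proof.
move=> Ax B; rewrite /= nbhsE => -[C [oC Cx] CB].
change (nbhs x [set y | D y -> B (g y)]); rewrite nbhsE.
(* Adjoining all points off [A] to the preimage of [C] makes it open in the whole realization. *)
exists [set y | A (finsupp (val y)) -> C (g y)].
  split=> //; apply/coherent_openP => s y Xs sy Ay.
  apply: cell_nbhs_glue => // t At ty; apply: gA => //.
  apply: open_nbhs_nbhs; split=> //; apply: Ay.
  by apply: Ad ty => //; exact/simplex_neq0/supp_simplex.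
by move=> y /= Cy Ay; exact/CB/Cy.
Qed.

End ContOn.

Lemma cont_onP (T : topologicalType) (g : realization R X -> T) :
  continuous g <-> cont_on (simplex X) g.
Proof.
split=> [gc s x Xs sx|gX x].
  exact: cvg_comp (@cell_nbhs_cvg s x) (gc x).
have Xd s t : X s -> t != fset0 -> (t `<=` s)%fset -> X t.
  by move=> Xs t0 ts; exact: simplex_sub ts t0.
have := cont_on_within Xd gX (supp_simplex x); apply: cvg_trans.
apply: cvg_app => B H.
change (nbhs x [set y : realization R X | X (finsupp (val y)) -> B y]) in H.
by apply: filterS H => y; apply; exact: supp_simplex.
Qed.

(** Coordinatewise convergence is uniform on the finite set [W], and off [W] all the coordinates
    vanish. *)
Lemma cvg_cell_nbhs (Z : Type) (F : set_system Z) (f : Z -> realization R X)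
    W x : Filter F ->
  closed_cell W x -> (\forall z \near F, closed_cell W (f z)) ->
  (forall v, v \in W -> val (f z) v @[z --> F] --> val x v) ->
  f @ F --> cell_nbhs W x.
Proof.
move=> FF Wx Wf fx A [e e0 eA].
have : forall l : seq V, {subset l <= W} ->
    \forall z \near F, forall v, v \in l -> `|val x v - val (f z) v| < e.
  elim=> [|v l IH] lW; first exact: nearW.
  have {}IH := IH (fun u ul => lW u (mem_behead (s := v :: l) ul)).
  have /cvgrPdist_lt/(_ _ e0) Hv := fx v (lW v (mem_head v l)).
  near=> z => u; rewrite inE => /orP[/eqP->|]; first by near: z.
  by move: u; near: z.
move=> /(_ W (fun v => id)) H; rewrite /nbhs/=.
near=> z; apply: eA; first by near: z.
move=> v; have [vW|vW] := boolP (v \in W); first by move: v vW; near: z.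
have out y : closed_cell W y -> val y v = 0.
  by move=> /fsubsetP Wy; apply: fsfun_dflt; apply: contra vW; exact: Wy.
rewrite !out ?subrr ?normr0 //; near: z; exact: Wf.
Unshelve. all: by end_near. Qed.

(** The criterion for maps given by coordinates. The common finite [W] is essential: on an infinite
    complex, coordinatewise convergence can be weaker than coherent convergence. *)
Lemma cvg_realization (Z : Type) (F : set_system Z) (f : Z -> realization R X)
    W x : Filter F ->
  closed_cell W x -> (\forall z \near F, closed_cell W (f z)) ->
  (forall v, v \in W -> val (f z) v @[z --> F] --> val x v) ->
  f @ F --> x.
Proof.
move=> FF Wx Wf fx; apply: cvg_trans (@cell_nbhs_cvg W x).
exact: cvg_cell_nbhs.
Qed.

Lemma cvg_coord W x v : bc y v @[y --> cell_nbhs W x] --> val x v.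
Proof.
apply/cvgrPdist_lt => e e0.
by apply: filterS (near_coord W x e0) => y; exact.
Qed.

End CellFilter.

(** * Products with the unit interval *)

Section Tube.
Variables (R : realType) (V : choiceType) (X : scomplex V).
Variables (T : topologicalType) (H : realization R X * R -> T).

Hypothesis HX : forall s x (t : R), X s -> closed_cell s x -> t \in `[0, 1] ->
  H p @[p --> (cell_nbhs s x, within `[0, 1]%classic (nbhs t))] --> H (x, t).

(* The unit interval is locally compact, so its product with the coherent
   topology is again coherent. *)
Lemma continuous_on_cells_times_itv :
  {within [set: realization R X] `*` `[0, 1], continuous H}.
Proof.
apply/subspace_continuousP => -[x t] [_ /= It] B.
rewrite /= nbhsE => -[C [oC Cx] CB].
have sx : closed_cell (finsupp (val x)) x by exact: fsubset_refl.
have /= := HX (supp_simplex x) sx It (open_nbhs_nbhs (conj oC Cx)).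
move=> [[P Q] /= [[e e0 eP] /nbhs_ballP[d /= d0 dQ]] PQ].
have Px : P x by apply: eP => // v; rewrite subrr normr0.
(* The closed interval of radius [d / 2] about [t], cut down to the unit interval: compact, and
   inside the ball of radius [d]. *)
pose a := Num.max 0 (t - d / 2); pose b := Num.min 1 (t + d / 2).
have JI u : u \in `[a, b] -> u \in `[0, 1].
  by rewrite !in_itv /= ge_max le_min => /andP[/andP[-> _] /andP[-> _]].
pose A := [set y : realization R X |
  forall u : R, u \in `[a, b] -> C (H (y, u))].
have Ax : A x.
  move=> u Ju; apply: (PQ (x, u)); split => //=; apply: dQ; last exact: JI.
  move: Ju; rewrite /ball /= in_itv /= ge_max le_min distrC ltr_norml.
  by move=> /andP[/andP[_ ?] /andP[_ ?]]; apply/andP; split; lra.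
(* The tube lemma in each cell, over the compact interval from [a] to [b]. *)
have oA : open A.
  apply/coherent_openP => s y Xs sy Ay.
  have /compact_near_coveringP/near_covering_withinP cJ :=
    @segment_compact R a b.
  apply: (cJ _ (cell_nbhs s y) (fun z u => C (H (z, u)))) => u Ju.
  have := HX Xs sy (JI _ Ju) (open_nbhs_nbhs (conj oC (Ay _ Ju))).
  move=> [[P' Q'] /= [yP' uQ'] PQ'].
  exists ([set u | u \in `[0, 1] -> Q' u], P') => //= -[u' z] /= [Q'u' P'z] Ju'.
  by apply: (PQ' (z, u')); split => //; apply/Q'u'/JI.
exists (A, ball t (d / 2)) => /=.
  split; first exact: open_nbhs_nbhs.
  by apply: nbhsx_ballx; lra.
move=> [y u] /= [Ay tu] [_ Iu]; apply/CB/Ay.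
move: tu Iu; rewrite /ball /= !in_itv /= ge_max le_min ltr_norml.
by move=> /andP[? ?] /andP[-> ->] /=; apply/andP; split; lra.
Qed.

End Tube.

(** On the cell of [s], a coordinate of the image is a sum over part of [s] instead of the varying
    support, hence a fixed finite sum of continuous coordinates. *)
Lemma realization_map_continuous (R : realType) (V W : choiceType)
    (K : scomplex V) (L : scomplex W) (f : V -> W) (fKL : simplicial K L f) :
  continuous (@realization_map R V W K L f fKL).
Proof.
apply/cont_onP => s x Ks sx.
have cellf y : closed_cell s y ->
    closed_cell (f @` s)%fset (realization_map fKL y).
  rewrite /closed_cell /= => /fsubsetP sy; apply/fsubsetP => w.
  rewrite finsupp_pushforward; last by move=> v; exact: coord_ge0.
  by move=> /imfsetP[v /= /sy vs ->]; rewrite in_imfset.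
have E w y : closed_cell s y ->
    val (realization_map fKL y) w = \sum_(v <- s | f v == w) val y v.
  move=> sy; rewrite /= pushforwardE !(big_mkcond (fun v => f v == w)).
  apply: big_fset_incl => // v _; rewrite mem_finsupp negbK => /eqP ->.
  by case: ifP.
apply: (@cvg_realization _ _ _ _ _ _ (f @` s)%fset); first exact: cellf.
  by apply: filterS (near_cell s x) => y; exact: cellf.
move=> w _; rewrite E //.
apply: (@cvg_trans _ (\sum_(v <- s | f v == w) val (y : realization R K) v
   @[y --> cell_nbhs s x])).
  apply: near_eq_cvg; apply: filterS (near_cell s x) => y sy.
  by rewrite -E.
apply: (cvg_big (op := +%R)) => [|v _]; first exact: add_continuous.
exact: cvg_coord.
Qed.

(** * Homotopies *)

Lemma cvg_minr (R : realType) (Z : Type) (F : set_system Z) (f g : Z -> R)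
    (a b : R) : Filter F ->
  f @ F --> a -> g @ F --> b -> Num.min (f z) (g z) @[z --> F] --> Num.min a b.
Proof.
move=> FF fa gb; rewrite minr_absE; under eq_cvg do rewrite minr_absE.
apply: cvgM; [|exact: cvg_cst]; apply: cvgD; first exact: cvgD.
by apply: cvgN; apply: cvg_norm; apply: cvgB.
Qed.

Lemma within_eq_continuous (S T : topologicalType) (A : set S) (f g : S -> T) :
  (forall x, A x -> f x = g x) ->
  {within A, continuous f} -> {within A, continuous g}.
Proof.
move=> fg; apply: (@subspace_eq_continuous S A T f g) => x /set_mem.
exact: fg.
Qed.

Section Homotopy.
Variable R : realType.

(** Composition of a homotopy with a varying time. Continuity is only given over the unit interval,
    so the time has to stay there. *)
Lemma homotopy_cvg (X Y : topologicalType) (H : X * R -> Y) (Z : Type)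
    (F : set_system Z) (f : Z -> X) (t : Z -> R) x t0 : Filter F ->
  {within [set: X] `*` `[0, 1], continuous H} ->
  f @ F --> x -> t @ F --> t0 -> (\forall z \near F, t z \in `[0, 1]) ->
  t0 \in `[0, 1] -> H (f z, t z) @[z --> F] --> H (x, t0).
Proof.
move=> FF /subspace_continuousP Hc fx tt tI t0I.
have /Hc cH : ([set: X] `*` `[0, 1]) (x, t0) by [].
apply: (cvg_trans _ cH).
apply: (@cvg_comp _ _ _ (fun z => (f z, t z)) H F
  (within ([set: X] `*` `[0, 1]) (nbhs (x, t0)))) => //.
move=> B /= wB.
change (nbhs (x, t0) [set p | ([set: X] `*` `[0, 1]) p -> B p]) in wB.
have h : F [set z | ([set: X] `*` `[0, 1]) (f z, t z) -> B (f z, t z)].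
  exact: cvg_pair fx tt _ wB.
change (F [set z | B (f z, t z)]).
apply: filterS (filterI h tI) => z [hz tz]; exact: hz.
Qed.

Lemma homotopicP (X Y : topologicalType) (H : X * R -> Y) :
  (forall (x : X) (t : R), t \in `[0, 1] ->
    H p @[p --> within ([set: X] `*` `[0, 1]) (nbhs (x, t))] --> H (x, t)) ->
  {within [set: X] `*` `[0, 1], continuous H}.
Proof. by move=> h; apply/subspace_continuousP => -[x t] [_ /h]. Qed.

Let cvg1 (X : topologicalType) (D : set (X * R)) (x : X) (t : R) :
  p.1 @[p --> within D (nbhs (x, t))] --> x.
Proof. by apply: cvg_within_filter; exact: cvg_fst. Qed.

Let cvg2 (X : topologicalType) (D : set (X * R)) (x : X) (t : R) :
  p.2 @[p --> within D (nbhs (x, t))] --> t.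
Proof. by apply: cvg_within_filter; exact: cvg_snd. Qed.

Let near2 (X : topologicalType) (D : set (X * R)) (x : X) (t : R) :
  \forall p \near within D (nbhs (x, t)), D p.
Proof. exact: withinT. Qed.

Lemma homotopic_comp (X X' Y Y' : topologicalType) (h : X' -> X)
    (k : Y -> Y') (f g : X -> Y) :
  continuous h -> continuous k ->
  homotopic R f g -> homotopic R (k \o f \o h) (k \o g \o h).
Proof.
move=> ch ck [H [Hc H0 H1]]; exists (fun p => k (H (h p.1, p.2))).
split=> [|x|x]; [|by rewrite H0|by rewrite H1].
apply: homotopicP => x t tI.
suff Hh : H (h p.1, p.2) @[p --> within ([set: X'] `*` `[0, 1]) (nbhs (x, t))]
    --> H (h x, t) by exact: cvg_comp Hh (ck _).
apply: homotopy_cvg => //.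
- exact: cvg_comp (@cvg1 _ _ x t) (ch _).
- by apply: filterS (@near2 _ _ x t) => p [].
Qed.

Lemma homotopic_sym (X Y : topologicalType) (f g : X -> Y) :
  homotopic R f g -> homotopic R g f.
Proof.
move=> [H [Hc H0 H1]]; exists (fun p => H (p.1, 1 - p.2)).
split=> [|x|x]; [|by rewrite subr0 H1|by rewrite subrr H0].
have rI (t : R) : t \in `[0, 1] -> 1 - t \in `[0, 1].
  by rewrite !in_itv /=; lra.
apply: homotopicP => x t tI.
apply: homotopy_cvg => //; [| |exact: rI].
- by apply: cvgB; [exact: cvg_cst|exact: cvg2].
- by apply: filterS (@near2 _ _ x t) => p [_ /rI].
Qed.

Lemma homotopic_trans (X Y : topologicalType) (g f h : X -> Y) :
  homotopic R f g -> homotopic R g h -> homotopic R f h.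
Proof.
move=> [H [Hc H0 H1]] [G [Gc G0 G1]].
pose D1 := [set p : X * R | 0 <= p.2 <= 2^-1].
pose D2 := [set p : X * R | 2^-1 <= p.2 <= 1].
pose K p := if p.2 <= 2^-1 then H (p.1, 2 * p.2) else G (p.1, 2 * p.2 - 1).
exists K; split=> [|x|x]; last 2 first.
- by rewrite /K /= invr_ge0 ler0n mulr0.
- rewrite /K /= ifF; last by apply/negbTE; rewrite -ltNge; lra.
  by rewrite -G1; congr (G (_, _)); lra.
have -> : [set: X] `*` `[0, 1] = D1 `|` D2.
  apply/seteqP; split=> -[x t]; rewrite /D1 /D2 /= in_itv /=.
    by case=> _; case: (leP t 2^-1) => ? /andP[? ?]; [left|right]; lra.
  by case=> ?; split=> //; lra.
have snd_closed (A : set R) : closed A -> closed [set p : X * R | A p.2].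
  by move=> cA; apply: (closed_comp _ cA) => p _; exact: cvg_snd.
apply: withinU_continuous.
- rewrite (_ : D1 = [set p | `[0, 2^-1]%classic p.2]); last first.
    by apply/seteqP; split=> p; rewrite /D1/= in_itv.
  by apply: snd_closed; exact: interval_closed.
- rewrite (_ : D2 = [set p | `[2^-1, 1]%classic p.2]); last first.
    by apply/seteqP; split=> p; rewrite /D2/= in_itv.
  by apply: snd_closed; exact: interval_closed.
- refine (@within_eq_continuous _ _ _
    (fun p : X * R => H (p.1, 2 * p.2)) _ _ _).
    by move=> p; rewrite /D1 /K /= => /andP[_ ->].
  apply/subspace_continuousP => -[x t] /= /andP[t0 t1].
  have I2 (u : R) : 0 <= u <= 2^-1 -> 2 * u \in `[0, 1].
    by rewrite in_itv /=; lra.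
  apply: (@homotopy_cvg _ _ H _ _ fst (fun p => 2 * p.2) x (2 * t)) => //;
    [| |by apply: I2; rewrite t0].
    by apply: cvgM; [exact: cvg_cst|exact: cvg2].
  by apply: filterS (@near2 _ _ x t) => p; exact: I2.
- refine (@within_eq_continuous _ _ _
    (fun p : X * R => G (p.1, 2 * p.2 - 1)) _ _ _).
    (* At the common time 1/2 both halves give [g]. *)
    move=> -[x t]; rewrite /D2 /K /= => /andP[t0 t1].
    case: ifPn => // t2; have -> : t = 2^-1 by lra.
    by rewrite mulfV ?pnatr_eq0// subrr G0 H1.
  apply/subspace_continuousP => -[x t] /= /andP[t0 t1].
  have I2 (u : R) : 2^-1 <= u <= 1 -> 2 * u - 1 \in `[0, 1].
    by rewrite in_itv /=; lra.
  apply: (@homotopy_cvg _ _ G _ _ fst (fun p => 2 * p.2 - 1) x (2 * t - 1))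
    => //; [| |by apply: I2; rewrite t0].
    apply: cvgB; last exact: cvg_cst.
    by apply: cvgM; [exact: cvg_cst|exact: cvg2].
  by apply: filterS (@near2 _ _ x t) => p; exact: I2.
Qed.

End Homotopy.

(** * Extension over a simplex *)

(** The simplex condition is asked of nonempty sets only: the support is nonempty since its weights
    sum to 1. *)
Lemma realization_setI (R : realType) (V : choiceType) (K : scomplex V)
    (z : {fsfun V -> R with 0}) (s : {fset V}) :
  (forall v, 0 <= z v) -> (finsupp z `<=` s)%fset -> \sum_(v <- s) z v = 1 ->
  (forall t, t != fset0 -> (t `<=` finsupp z)%fset -> K t) ->
  realization_set R K z.
Proof.
move=> z0 zs z1 Kz.
have z1' : \sum_(v <- finsupp z) z v = 1.
  by rewrite -[RHS]z1; apply: big_fset_incl => // v _;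
     rewrite mem_finsupp negbK => /eqP.
split=> //; apply: Kz; last exact: fsubset_refl.
apply/negP => /eqP e; move: z1'; rewrite e big_seq_fset0 => /esym/eqP.
by rewrite oner_eq0.
Qed.

Lemma realization_inj (R : realType) (V : choiceType) (K : scomplex V)
  (x y : realization R K) : (forall v, val x v = val y v) -> x = y.
Proof. by move=> xy; apply/val_inj/fsfunP. Qed.

Section Subcomplex.
Variables (R : realType) (W : choiceType) (C Y : scomplex W).
Hypothesis CY : simplex C `<=` simplex Y.

Lemma subcomplex_incl_subproof (x : realization R C) :
  val x \in realization_set R Y.
Proof. by have [x0 x1 /CY xs] := realizationP x; apply/mem_set; split. Qed.

Definition subcomplex_incl (x : realization R C) : realization R Y :=
  exist _ (val x) (subcomplex_incl_subproof x).

Lemma subcomplex_incl_continuous : continuous subcomplex_incl.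
Proof.
apply/cont_onP => s x Cs sx.
apply: (@cvg_realization _ _ _ _ _ _ s) => // [|v _]; first exact: near_cell.
exact: cvg_coord.
Qed.

(* A left inverse of the inclusion, with junk value x0 outside of C. *)
Definition subcomplex_retr (x0 : realization R C) (y : realization R Y) :
  realization R C := insubd x0 (val y).

Lemma subcomplex_retrE x0 (y : realization R Y) : C (finsupp (val y)) ->
  val (subcomplex_retr x0 y) = val y.
Proof.
by move=> Cy; rewrite insubdK//; have [? ? _] := realizationP y; exact/mem_set.
Qed.

Lemma subcomplex_retrK x0 (y : realization R Y) : C (finsupp (val y)) ->
  subcomplex_incl (subcomplex_retr x0 y) = y.
Proof. by move=> Cy; apply: val_inj; rewrite /= subcomplex_retrE. Qed.

(** The junk value [x0] is avoided by keeping the limit and the nearby values supported in [C],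
    where the retraction preserves coordinates. *)
Lemma cvg_subcomplex_retr (Z : Type) (F : set_system Z)
    (g : Z -> realization R Y) (y : realization R Y) x0 : Filter F ->
  g @ F --> y -> C (finsupp (val y)) ->
  (\forall z \near F, C (finsupp (val (g z)))) ->
  subcomplex_retr x0 (g z) @[z --> F] --> subcomplex_retr x0 y.
Proof.
move=> FF gy Cy Cg.
have Cd s t : C s -> t != fset0 -> (t `<=` s)%fset -> C t.
  by move=> Cs t0 ts; exact: simplex_sub ts t0.
have rc : cont_on (simplex C) (subcomplex_retr x0).
  move=> s x Cs sx.
  have sC z : closed_cell s z -> C (finsupp (val z)).
    by move=> sz; apply: Cd sz => //; exact/simplex_neq0/supp_simplex.
  apply: (@cvg_realization _ _ _ _ _ _ s).
  - by rewrite /closed_cell /= subcomplex_retrE //; exact: sC.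
  - apply: filterS (near_cell s x) => z sz.
    by rewrite /closed_cell /= subcomplex_retrE //; exact: sC.
  - move=> v _; rewrite subcomplex_retrE; last exact: sC.
    apply: cvg_trans (@cvg_coord _ _ _ s x v); apply: near_eq_cvg.
    by apply: filterS (near_cell s x) => z /sC/subcomplex_retrE ->.
have := cont_on_within Cd rc Cy; apply: cvg_comp => A.
move=> wA; have {wA}gA := gy _ wA.
change (F [set z | A (g z)]); apply: filterS (filterI gA Cg) => z [h /h].
exact.
Qed.

End Subcomplex.

Lemma cvg_bigmin1 (R : realType) (I : eqType) (Z : Type)
    (F : set_system Z) (l : seq I) (f : I -> Z -> R) (a : I -> R) : Filter F ->
  (forall i, i \in l -> f i @ F --> a i) ->
  \big[Num.min/1]_(i <- l) f i z @[z --> F] --> \big[Num.min/1]_(i <- l) a i.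
Proof.
move=> FF; elim: l => [|i l IH] fa.
  by rewrite big_nil; under eq_cvg do rewrite big_nil; exact: cvg_cst.
rewrite big_cons; under eq_cvg do rewrite big_cons.
apply: cvg_minr; first by apply: fa; rewrite mem_head.
by apply: IH => j jl; apply: fa; rewrite inE jl orbT.
Qed.

Lemma bigmin1_le (R : realType) (I : eqType) (l : seq I) (a : I -> R) i :
  i \in l -> \big[Num.min/1]_(i <- l) a i <= a i.
Proof.
elim: l => // j l IH; rewrite inE big_cons ge_min => /orP[/eqP->|/IH->].
  by rewrite lexx.
by rewrite orbT.
Qed.

(** The default value 1 is harmless because every entry is at most 1. *)
Lemma bigmin1_attained (R : realType) (I : eqType) (l : seq I) (a : I -> R) :
  (forall i, a i <= 1) -> l != [::] ->
  exists2 i, i \in l & \big[Num.min/1]_(i <- l) a i = a i.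
Proof.
move=> a1; elim: l => // i l IH _; rewrite big_cons.
have [->|l0] := eqVneq l [::].
  by exists i; rewrite ?mem_head// big_nil min_l.
have [j jl ->] := IH l0; case: (leP (a i) (a j)) => _.
  by exists i; rewrite ?mem_head.
by exists j; rewrite // inE jl orbT.
Qed.

Section ExtendSimplex.
Variables (R : realType) (V W : choiceType).
Variables (X : scomplex V) (C Y : scomplex W) (s : {fset V}).
Variables (B : set {fset V}) (g : realization R X -> realization R Y).
Hypothesis Xs : X s.
Hypothesis CY : simplex C `<=` simplex Y.
Hypothesis cC : contractible R (realization R C).
Hypothesis Bd : forall t u, B t -> u != fset0 -> (u `<=` t)%fset -> B u.
Hypothesis Bs : forall t, t != fset0 -> (t `<` s)%fset -> B t.
Hypothesis gB : cont_on B g.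
Hypothesis gC : forall x, (finsupp (val x) `<` s)%fset ->
  C (finsupp (val (g x))).
Implicit Types x : realization R X.

(** On the cell of [s], [t x] is the cone coordinate: 0 on the boundary, 1 at the barycentre [b].
    Away from [b], [x] is [t x] times [b] plus [1 - t x] times the boundary point [y x]. *)
Let n : R := #|` s|%:R.
Let m x : R := \big[Num.min/1]_(v <- s) val x v.
Let t x : R := n * m x.

Let ydef x : {fsfun V -> R with 0} :=
  [fsfun v in s => (val x v - m x) / (1 - t x) | 0].

(* The radial projection of x from the barycentre of s to the boundary of s;
   junk (x itself) at the barycentre. *)
Let y x : realization R X := insubd x (ydef x).

Let m_le x v : v \in s -> m x <= val x v.
Proof. by move=> vs; apply: bigmin1_le (fun v => val x v) _ vs. Qed.

Let m_ex x : exists2 v, v \in s & m x = val x v.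
Proof.
apply: (@bigmin1_attained R _ _ (fun v => val x v)) => [v|].
  exact: coord_le1.
by have := simplex_neq0 Xs; apply: contra => /eqP s0; apply/eqP/fsetP => v;
   rewrite -[v \in s]/(v \in enum_fset s) s0.
Qed.

Let m_ge0 x : 0 <= m x.
Proof. by have [v _ ->] := m_ex x; exact: coord_ge0. Qed.

Let t_ge0 x : 0 <= t x.
Proof. by rewrite mulr_ge0. Qed.

Let sum_m x : \sum_(v <- s) m x = t x.
Proof. by rewrite big_const_seq count_predT iter_addr_0 /t mulr_natl. Qed.

Let y_ge0 x : t x < 1 -> forall v, 0 <= ydef x v.
Proof.
move=> t1 v; rewrite fsfunE; case: ifPn => // vs.
by rewrite divr_ge0 ?subr_ge0 ?m_le// ltW.
Qed.

Let ydef_supp x : (finsupp (ydef x) `<` s)%fset.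
Proof.
have sub : (finsupp (ydef x) `<=` s)%fset.
  apply/fsubsetP => v; rewrite mem_finsupp fsfunE.
  by case: ifPn => //; rewrite eqxx.
rewrite fproperEneq sub andbT; have [v vs mv] := m_ex x.
apply/eqP => /fsetP/(_ v); rewrite vs mem_finsupp fsfunE vs mv subrr mul0r.
by rewrite eqxx.
Qed.

Let val_y x : closed_cell s x -> t x < 1 -> val (y x) = ydef x.
Proof.
move=> sx t1; rewrite /y insubdK //; apply/mem_set.
apply: (@realization_setI _ _ _ _ s); first exact: y_ge0.
- exact: fproper_sub (ydef_supp x).
- under eq_big_seq => v vs do rewrite fsfunE vs.
  rewrite -mulr_suml sumrB sum_m sum_coord // divff //.
  by rewrite subr_eq0 eq_sym lt_eqF.
- move=> u u0 us; apply: simplex_sub Xs _ u0.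
  by apply: fsubset_trans us _; exact: fproper_sub (ydef_supp x).
Qed.

Let t_cvg x : t z @[z --> cell_nbhs s x] --> t x.
Proof.
apply: cvgM; first exact: cvg_cst.
by apply: cvg_bigmin1 => v _; exact: cvg_coord.
Qed.

Let near_tlt x (a : R) : t x < a -> \forall z \near cell_nbhs s x, t z < a.
Proof. by move=> ta; exact: cvgr_lt (@t_cvg x) _ ta. Qed.

Let near_tgt x (a : R) : a < t x -> \forall z \near cell_nbhs s x, a < t z.
Proof. by move=> ta; exact: cvgr_gt (@t_cvg x) _ ta. Qed.

Let y_cvg x : closed_cell s x -> t x < 1 -> y z @[z --> cell_nbhs s x] --> y x.
Proof.
move=> sx t1; apply: (@cvg_realization _ _ _ _ _ _ s).
- by rewrite /closed_cell /= val_y //; exact: fproper_sub (ydef_supp x).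
- apply: filterS (filterI (near_cell s x) (near_tlt t1)) => z [sz tz].
  by rewrite /closed_cell /= val_y //; exact: fproper_sub (ydef_supp z).
move=> v vs; rewrite val_y // fsfunE vs.
apply: (@cvg_trans _ (((val (z : realization R X) v - m z) / (1 - t z))
  @[z --> cell_nbhs s x])).
  apply: near_eq_cvg.
  apply: filterS (filterI (near_cell s x) (near_tlt t1)) => z [sz tz].
  by rewrite val_y // fsfunE vs.
apply: cvgM.
  apply: cvgB; first exact: cvg_coord.
  by apply: cvg_bigmin1 => u _; exact: cvg_coord.
apply: cvgV; first by rewrite subr_eq0 gt_eqF.
by apply: cvgB; [exact: cvg_cst|exact: t_cvg].
Qed.

(** The cell is a cone from its barycentre over its boundary: [x] is sent to the point [g (y x)] of
    |C|, moved along the contraction of |C| for a time growing with [t x]. *)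
Lemma extend_simplex : exists h : realization R X -> realization R Y,
  [/\ forall x, closed_cell s x -> h @ cell_nbhs s x --> h x,
      forall x, (finsupp (val x) `<` s)%fset -> h x = g x &
      forall x, C (finsupp (val (h x)))].
Proof.
have [x0 [H [Hc H0 H1]]] := cC.
(* The time is 1 as soon as [t x] reaches 1/2, so [h] is constant around the barycentre and the junk
   value of [y] there does not matter. *)
pose h x := subcomplex_incl CY
  (H (subcomplex_retr x0 (g (y x)), Num.min (2 * t x) 1)).
have tI x : Num.min (2 * t x) 1 \in `[0, 1].
  by rewrite in_itv /= ge_min lexx orbT andbT le_min ler01 andbT mulr_ge0.
exists h; split; last by move=> x; exact: supp_simplex.
- move=> x sx; have [t1|t1] := ltP (t x) 1; last first.
    have t2 : 2^-1 < t x by apply: lt_le_trans t1; lra.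
    have hx0 z : 2^-1 < t z -> h z = subcomplex_incl CY x0.
      by move=> tz; rewrite /h min_r ?H1 //; lra.
    rewrite hx0 //.
    apply: (@cvg_trans _ (cst (subcomplex_incl CY x0) @ cell_nbhs s x));
      last exact: cvg_cst.
    apply: near_eq_cvg.
    by apply: filterS (near_tgt t2) => z /hx0 ->.
  have ys z : closed_cell s z -> t z < 1 -> (finsupp (val (y z)) `<` s)%fset.
    by move=> sz tz; rewrite val_y.
  have By z : closed_cell s z -> t z < 1 -> B (finsupp (val (y z))).
    move=> sz tz; apply: Bs; first exact/simplex_neq0/supp_simplex.
    exact: ys.
  have gy : g (y z) @[z --> cell_nbhs s x] --> g (y x).
    have gw := cont_on_within Bd gB (By _ sx t1).
    apply: cvg_comp gw => A wA; have {wA}yA := y_cvg sx t1 wA.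
    change (cell_nbhs s x [set z | B (finsupp (val (y z))) -> A (y z)]) in yA.
    change (cell_nbhs s x [set z | A (y z)]).
    apply: filterS (filterI yA (filterI (near_cell s x) (near_tlt t1))).
    by move=> z [h1 [h2 h3]]; apply/h1/By.
  have rgy : subcomplex_retr x0 (g (y z)) @[z --> cell_nbhs s x] -->
      subcomplex_retr x0 (g (y x)).
    apply: cvg_subcomplex_retr => //; first exact/gC/ys.
    apply: filterS (filterI (near_cell s x) (near_tlt t1)) => z [sz tz].
    exact/gC/ys.
  suff cH : H (subcomplex_retr x0 (g (y z)), Num.min (2 * t z) 1)
      @[z --> cell_nbhs s x] -->
      H (subcomplex_retr x0 (g (y x)), Num.min (2 * t x) 1).
    by apply: (cvg_comp _ _ cH); exact: subcomplex_incl_continuous.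
  apply: homotopy_cvg => //; last by apply: nearW => z; exact: tI.
  apply: cvg_minr; last exact: cvg_cst.
  by apply: cvgM; [exact: cvg_cst|exact: t_cvg].
- move=> x xs; have sx : closed_cell s x by exact: fproper_sub.
  have m0 : m x = 0.
    have [v vs] : exists2 v, v \in s & v \notin finsupp (val x).
      by move: xs; rewrite fproperE => /andP[_ /fsubsetPn].
    rewrite mem_finsupp negbK => /eqP xv.
    by apply/eqP; rewrite eq_le m_ge0 -xv m_le.
  have t0 : t x = 0 by rewrite /t m0 mulr0.
  have yx : y x = x.
    apply: realization_inj => v; rewrite val_y ?t0 // fsfunE m0 t0 !subr0 divr1.
    case: ifPn => // vs; apply/esym/fsfun_dflt.
    by apply: contra vs; move/fsubsetP: sx; exact.
  rewrite /h yx t0 mulr0 min_l // H0 subcomplex_retrK //; exact: gC.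
Qed.

End ExtendSimplex.

(** * Carriers *)

Lemma contractible_point (R : realType) (X : topologicalType) :
  contractible R X -> X.
Proof. by move=> /cid[x _]. Qed.

Section Carrier.
Variables (R : realType) (V W : choiceType).
Variables (X : scomplex V) (Y : scomplex W) (C : {fset V} -> scomplex W).
Hypothesis C_mono : forall s t, X s -> t != fset0 -> (t `<=` s)%fset ->
  simplex (C t) `<=` simplex (C s).
Hypothesis CY : forall s, X s -> simplex (C s) `<=` simplex Y.
Hypothesis C_contr : forall s, X s -> contractible R (realization R (C s)).

Section Extension.
Variables (A : set {fset V}) (g0 : realization R X -> realization R Y).
Hypothesis Ad : forall s t, A s -> t != fset0 -> (t `<=` s)%fset -> A t.
Hypothesis g0A : cont_on A g0.
Hypothesis g0C : forall x, A (finsupp (val x)) ->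
  C (finsupp (val x)) (finsupp (val (g0 x))).

(** The relative skeleton, indexed by number of vertices rather than by dimension; thus [D 0] has
    the same nonempty members as [A]. *)
Let D n : set {fset V} := [set s | A s \/ X s /\ (#|` s| <= n)%N].

Let Dd n s t : D n s -> t != fset0 -> (t `<=` s)%fset -> D n t.
Proof.
move=> [As|[Xs sn]] t0 ts; [left; exact: Ad ts|right; split].
  exact: simplex_sub ts t0.
exact: leq_trans (fsubset_leq_card ts) sn.
Qed.

Let P n (g : realization R X -> realization R Y) :=
  [/\ cont_on (D n) g, forall x, A (finsupp (val x)) -> g x = g0 x &
      forall x, D n (finsupp (val x)) ->
        C (finsupp (val x)) (finsupp (val (g x)))].

Let supp_neq0 (x : realization R X) : finsupp (val x) != fset0.
Proof. exact: simplex_neq0 (supp_simplex x). Qed.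

Let step n g : P n g -> exists g', P n.+1 g' /\
  forall x, D n (finsupp (val x)) -> g' x = g x.
Proof.
move=> [gc gA gC].
have Dsub s t : X s -> #|` s| = n.+1 -> t != fset0 -> (t `<` s)%fset -> D n t.
  move=> Xs sn t0 ts; right; split.
    exact: simplex_sub (fproper_sub ts) t0.
  by rewrite -ltnS -sn; exact: fproper_ltn_card.
(* Choice extends [g] over all simplices with [n.+1] vertices at once. *)
have /choice[h hP] s : exists h : realization R X -> realization R Y,
    X s -> #|` s| = n.+1 ->
    [/\ forall x, closed_cell s x -> h @ cell_nbhs s x --> h x,
        forall x, (finsupp (val x) `<` s)%fset -> h x = g x &
        forall x, C s (finsupp (val (h x)))].
  have [[Xs sn]|nXs] := pselect (X s /\ #|` s| = n.+1); last first.
    by exists g => Xs sn; case: nXs.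
  have gCs x : (finsupp (val x) `<` s)%fset -> C s (finsupp (val (g x))).
    move=> xs; apply: (C_mono Xs (supp_neq0 x) (fproper_sub xs)).
    exact/gC/(Dsub s).
  have [h hP] := extend_simplex Xs (CY Xs) (C_contr Xs) (@Dd n)
    (fun t => @Dsub s t Xs sn) gc gCs.
  by exists h.
pose g' x :=
  if `[< D n (finsupp (val x)) >] then g x else h (finsupp (val x)) x.
have g'g x : D n (finsupp (val x)) -> g' x = g x.
  by move=> Dx; rewrite /g' ifT //; exact/asboolP.
(* The agreement holds on the whole closed cell, because [h s] equals [g] on the proper faces;
   continuity of [g'] on a new cell follows. *)
have g'h s x : ~ D n s -> D n.+1 s -> closed_cell s x -> g' x = h s x.
  move=> nDs [As|[Xs sn1]] sx; first by case: nDs; left.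
  have sn : #|` s| = n.+1.
    apply/eqP; rewrite eqn_leq sn1 ltnNge; apply/negP => sn.
    by apply: nDs; right.
  have [_ hg _] := hP _ Xs sn.
  have [xs|xs] := eqVfproper sx.
    by rewrite /g' -xs; case: asboolP => // Dx; case: nDs; rewrite -xs.
  rewrite (hg x xs); apply: g'g; exact: Dsub xs.
exists g'; split=> //; split.
- move=> s x Ds sx; have [Dns|nDs] := pselect (D n s).
    have cg z : closed_cell s z -> g' z = g z.
      by move=> sz; apply: g'g; apply: Dd sz.
    rewrite cg //; apply: cvg_trans (gc s x Dns sx); apply: near_eq_cvg.
    by apply: filterS (near_cell s x) => z /cg ->.
  have [Xs sn] : X s /\ #|` s| = n.+1.
    case: Ds => [As|[Xs sn]]; first by case: nDs; left.
    split=> //; apply/eqP; rewrite eqn_leq sn ltnNge.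
    by apply/negP => {}sn; apply: nDs; right.
  have [hc _ _] := hP _ Xs sn.
  rewrite (g'h s) //; apply: cvg_trans (hc x sx); apply: near_eq_cvg.
  by apply: filterS (near_cell s x) => z sz; rewrite (g'h s).
- by move=> x Ax; rewrite g'g ?gA //; left.
- move=> x Dx; have [Dnx|nDx] := pselect (D n (finsupp (val x))).
    by rewrite g'g //; exact: gC.
  rewrite (g'h _ _ nDx Dx); last exact: fsubset_refl.
  have [Xs sn] : X (finsupp (val x)) /\ #|` finsupp (val x)| = n.+1.
    case: Dx => [As|[Xs sn]]; first by case: nDx; left.
    split=> //; apply/eqP; rewrite eqn_leq sn ltnNge.
    by apply/negP => {}sn; apply: nDx; right.
  by have [_ _] := hP _ Xs sn; exact.
Qed.

(** Induction over skeleta. The values at a point no longer change once its support has been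
    reached, so the stages have a limit. *)
Lemma carrier_extension : exists g : realization R X -> realization R Y,
  [/\ continuous g, forall x, A (finsupp (val x)) -> g x = g0 x &
      forall x, C (finsupp (val x)) (finsupp (val (g x)))].
Proof.
have D0 s : D 0 s -> s != fset0 -> A s.
  by move=> [//|[_]]; rewrite leqn0 cardfs_eq0 => ->.
have P0 : P 0 g0.
  split=> // [s x Ds sx|x Dx]; last exact/g0C/D0.
  apply: g0A => //; apply: D0 Ds _.
  move: sx; rewrite /closed_cell /= => /fsubsetP sx.
  by have /fset0Pn[v /sx vs] := supp_neq0 x; apply/fset0Pn; exists v.
have stepT n (g : {g | P n g}) : {g' : {g' | P n.+1 g'} |
    forall x, D n (finsupp (val x)) -> sval g' x = sval g x}.
  by have /cid[g' [Pg' gg']] := step (svalP g); exists (exist _ g' Pg').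
(* Recursion on maps bundled with their invariant, so that each stage extends the one actually
   chosen before it. *)
pose G := nat_rect (fun n => {g | P n g}) (exist _ g0 P0)
  (fun n g => sval (stepT n g)).
have GS n x : D n (finsupp (val x)) -> sval (G n.+1) x = sval (G n) x.
  exact: (svalP (stepT n (G n))).
pose g x := sval (G #|` finsupp (val x)|) x.
have gG n x : D n (finsupp (val x)) -> (#|` finsupp (val x)| <= n)%N ->
    g x = sval (G n) x.
  move=> _ /subnKC <-; elim: (n - _)%N => [|k IH]; first by rewrite addn0.
  rewrite addnS GS //; right; split; first exact: supp_simplex.
  exact: leq_addr.
have DX n s : X s -> (#|` s| <= n)%N -> D n s by move=> Xs sn; right.
exists g; split.
- apply/cont_onP => s x Xs sx.
  have [gc _ _] := svalP (G #|` s|).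
  have cg z : closed_cell s z -> g z = sval (G #|` s|) z.
    move=> sz; apply: gG; last exact: fsubset_leq_card.
    by apply: DX; [exact: supp_simplex|exact: fsubset_leq_card].
  rewrite cg //; apply: cvg_trans (gc s x (DX _ _ Xs (leqnn _)) sx).
  apply: near_eq_cvg.
  by apply: filterS (near_cell s x) => z /cg ->.
- by move=> x; have [_ + _] := svalP (G #|` finsupp (val x)|); exact.
- move=> x; have [_ _] := svalP (G #|` finsupp (val x)|); apply.
  exact/DX/leqnn/supp_simplex.
Qed.

End Extension.

Lemma carrier_map : exists g : realization R X -> realization R Y,
  continuous g /\ forall x, C (finsupp (val x)) (finsupp (val (g x))).
Proof.
(* With [A] empty nothing is prescribed, but a starting function is still needed; contractibility
   supplies its values. *)
pose g0 (x : realization R X) := subcomplex_incl (CY (supp_simplex x))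
  (contractible_point (C_contr (supp_simplex x))).
have [||x []|g [gc _ gC]] := @carrier_extension set0 g0 => //.
by exists g.
Qed.

End Carrier.

(** * The prism over a complex of chains *)

Lemma sum_fset_boolX (R : realType) (T : choiceType) (A : {fset T})
    (F : T * bool -> R) :
  \sum_(u <- (A `*` [fset true; false])%fset) F u =
  \sum_(p <- A) (F (p, true) + F (p, false)).
Proof.
rewrite (perm_big [seq (p, b) | p <- A, b <- [:: true; false]]); last first.
  apply: uniq_perm; first exact: fset_uniq.
    by rewrite allpairs_uniq ?fset_uniq // => -[? ?] [? ?].
  move=> [p b]; rewrite in_fsetM !inE; apply/andP/allpairsP => [[pA _]|].
    by exists (p, b); split=> //=; rewrite !inE; case: (b).
  by move=> [[q c] [/= qA _ [-> ->]]]; split=> //; case: c.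
rewrite big_allpairs; apply: eq_bigr => p _.
by rewrite big_cons big_seq1.
Qed.

Lemma pushforward_sup (R : realType) (V W : choiceType) (f : V -> W)
    (x : {fsfun V -> R with 0}) (A : {fset V}) w : (finsupp x `<=` A)%fset ->
  Defs.pushforward f x w = \sum_(v <- A) if f v == w then x v else 0.
Proof.
move=> xA; rewrite pushforwardE big_mkcond; apply: big_fset_incl => // v _.
by rewrite mem_finsupp negbK => /eqP->; case: ifP.
Qed.

Section Prism.
Variables (R : realType) (d : Order.disp_t) (P : porderType d).
Variable X : scomplex P.
Hypothesis X_chain : forall s, X s -> chain s.

(** When [X] consists of chains, these are the chains over simplices of [X] in the product of [P]
    with [false < true]. *)
Definition prism_simplex : set {fset P * bool} :=
  [set s | X (fst @` s)%fset /\
    forall p q, (p, true) \in s -> (q, false) \in s -> (q <= p)%O].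

Lemma prism_simplex_neq0 s : prism_simplex s -> s != fset0.
Proof.
move=> [/simplex_neq0/fset0Pn[p /imfsetP[u /= us _]] _].
by apply/fset0Pn; exists u.
Qed.

Lemma prism_simplex_sub s t : prism_simplex s -> (t `<=` s)%fset ->
  t != fset0 -> prism_simplex t.
Proof.
move=> [Xs sP] ts t0; split; last first.
  by move: ts => /fsubsetP ts p q /ts ps /ts; exact: sP.
apply: simplex_sub Xs _ _; first by apply: subset_imfset; exact/fsubsetP.
have /fset0Pn[u ut] := t0; apply/fset0Pn; exists u.1.
by apply/imfsetP; exists u.
Qed.

Definition prism : scomplex (P * bool)%type :=
  SComplex prism_simplex_neq0 prism_simplex_sub.

Implicit Types (x : realization R X) (t : R) (p q : P).

(** [S x p] is the left end of the interval of [p] in the subdivision of the unit interval by [x];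
    [low x t p] is the length of its part below [1 - t]. *)
Let S x p : R := \sum_(q <- finsupp (val x) | (q < p)%O) val x q.

Let low x t p : R :=
  Num.min (S x p + val x p) (1 - t) - Num.min (S x p) (1 - t).

Let dbl (A : {fset P}) : {fset P * bool} := (A `*` [fset true; false])%fset.

Let in_dbl A p b : ((p, b) \in dbl A) = (p \in A).
Proof. by rewrite in_fsetM !inE /=; case: b; rewrite andbT. Qed.

(* The coordinates of x cut [0, 1] into consecutive intervals, ordered along
   the chain; the parts of the interval of p below and above 1 - t become the
   weights of (p, false) and (p, true). *)
Let shuffle_fun (u : realization R X * R) : {fsfun P * bool -> R with 0} :=
  [fsfun v in dbl (finsupp (val u.1)) =>
    if v.2 then val u.1 v.1 - low u.1 u.2 v.1 else low u.1 u.2 v.1 | 0].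

Let low0 x t p : val x p = 0 -> low x t p = 0.
Proof. by move=> xp; rewrite /low xp addr0 subrr. Qed.

Let shuffle_funE x t p b : shuffle_fun (x, t) (p, b) =
  if b then val x p - low x t p else low x t p.
Proof.
rewrite fsfunE in_dbl /=; case: ifPn => //.
by rewrite mem_finsupp negbK => /eqP xp; rewrite low0 // xp subrr; case: b.
Qed.

Let low_ge0 x t p : 0 <= low x t p.
Proof.
have xp := coord_ge0 x p; rewrite /low subr_ge0.
by rewrite le_min !ge_min lexx orbT andbT lerDl xp.
Qed.

Let low_le x t p : low x t p <= val x p.
Proof.
have xp := coord_ge0 x p; rewrite /low.
by case: (leP (S x p) (1 - t)); case: (leP (S x p + val x p) (1 - t)); lra.
Qed.

Let S_lt x p q : p \in finsupp (val x) -> (p < q)%O ->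
  S x p + val x p <= S x q.
Proof.
move=> px pq; rewrite /S [leRHS]big_mkcond (big_fsetD1 p) //= pq addrC lerD2r.
rewrite big_mkcond (big_fsetD1 p) //= ltxx add0r ler_sum // => r _.
by case: ifPn => [/lt_trans -> //|_]; case: ifP => // _; exact: coord_ge0.
Qed.

Let S_ge0 x p : 0 <= S x p.
Proof. by rewrite sumr_ge0 // => q _; exact: coord_ge0. Qed.

Let S_le1 x p : S x p + val x p <= 1.
Proof.
have [px|] := boolP (p \in finsupp (val x)); last first.
  rewrite mem_finsupp negbK => /eqP->; rewrite addr0.
  rewrite -(sum_coord (fsubset_refl _ : closed_cell _ x)) /S big_mkcond.
  by rewrite ler_sum // => r _; case: ifP => // _; exact: coord_ge0.
rewrite -(sum_coord (fsubset_refl _ : closed_cell _ x)) /S.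
rewrite [leRHS](big_fsetD1 p) //= [leRHS]addrC lerD2r.
rewrite big_mkcond (big_fsetD1 p) //= ltxx add0r ler_sum // => r _.
by case: ifP => // _; exact: coord_ge0.
Qed.

Let shuffle_supp u :
  (finsupp (shuffle_fun u) `<=` dbl (finsupp (val u.1)))%fset.
Proof.
apply/fsubsetP => v; rewrite mem_finsupp fsfunE.
by case: ifPn => //; rewrite eqxx.
Qed.

Let shuffle_ge0 u v : 0 <= shuffle_fun u v.
Proof.
case: u v => x t [p b]; rewrite shuffle_funE; case: b => //.
by rewrite subr_ge0.
Qed.

Let shuffle_proj u p : Defs.pushforward fst (shuffle_fun u) p = val u.1 p.
Proof.
case: u => x t; rewrite (pushforward_sup _ _ (shuffle_supp _)).
rewrite sum_fset_boolX /=.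
under eq_bigr do rewrite !shuffle_funE.
have [px|px] := boolP (p \in finsupp (val x)).
  rewrite (big_fsetD1 p) //= eqxx subrK big1_seq ?addr0 // => q.
  by rewrite !inE => /andP[_ /andP[/negPf->]]; rewrite addr0.
rewrite (fsfun_dflt px) big1_seq // => q /andP[_ qx]; case: eqP => [qp|].
  by rewrite -qp qx in px.
by rewrite addr0.
Qed.

Lemma shuffle_subproof u : shuffle_fun u \in realization_set R prism.
Proof.
apply/mem_set; apply: (@realization_setI _ _ _ _ (dbl (finsupp (val u.1)))).
- exact: shuffle_ge0.
- exact: shuffle_supp.
- case: u => x t; rewrite sum_fset_boolX.
  rewrite -[RHS](sum_coord (fsubset_refl _ : closed_cell _ x)).
  by apply: eq_bigr => p _; rewrite !shuffle_funE subrK.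
- move=> s s0 su; apply: prism_simplex_sub su s0; split.
    have -> : (fst @` finsupp (shuffle_fun u))%fset = finsupp (val u.1).
      rewrite -(finsupp_pushforward fst (shuffle_ge0 u)); apply/fsetP => p.
      by rewrite !mem_finsupp shuffle_proj.
    exact: supp_simplex.
  case: u => x t p q; rewrite !mem_finsupp !shuffle_funE => lp lq.
  have px : p \in finsupp (val x).
    rewrite mem_finsupp; apply: contraNneq lp => xp.
    by rewrite low0 // xp subrr.
  have qx : q \in finsupp (val x).
    by rewrite mem_finsupp; apply: contraNneq lq => xp; rewrite low0.
  have /orP[pq|//] := X_chain (supp_simplex x) px qx.
  move: pq; rewrite le_eqVlt => /orP[/eqP->//|pq].
  (* For [p < q] the interval of [p] ends before that of [q] starts. A cut at or before the start of
     [q] leaves [(q, false)] no weight; a later cut leaves [(p, true)] none. *)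
  have Spq := S_lt px pq; have [qt|qt] := leP (1 - t) (S x q).
    have : low x t q = 0.
      rewrite /low !min_r ?subrr //.
      by apply: le_trans qt _; rewrite lerDl; exact: coord_ge0.
    by move/eqP; rewrite (negPf lq).
  have : val x p - low x t p = 0.
    have pt : S x p + val x p <= 1 - t by apply: le_trans Spq (ltW qt).
    rewrite /low !min_l //; first lra.
    by apply: le_trans pt; rewrite lerDl; exact: coord_ge0.
  by move/eqP; rewrite (negPf lp).
Qed.

Definition shuffle (u : realization R X * R) : realization R prism :=
  exist _ (shuffle_fun u) (shuffle_subproof u).

Lemma shuffle0 x p b :
  val (shuffle (x, 0)) (p, b) = if b then 0 else val x p.
Proof.
have -> : val (shuffle (x, 0)) (p, b) = shuffle_fun (x, 0) (p, b) by [].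
rewrite shuffle_funE /low subr0 !min_l ?S_le1 //; last first.
  by apply: le_trans (S_le1 x p); rewrite lerDl; exact: coord_ge0.
by case: b; lra.
Qed.

Lemma shuffle1 x p b :
  val (shuffle (x, 1)) (p, b) = if b then val x p else 0.
Proof.
have -> : val (shuffle (x, 1)) (p, b) = shuffle_fun (x, 1) (p, b) by [].
rewrite shuffle_funE /low subrr !min_r ?S_ge0 ?addr_ge0 ?S_ge0 ?coord_ge0 //.
by case: b; lra.
Qed.

Lemma prism_fst_simplicial : simplicial prism X fst.
Proof. by move=> s []. Qed.

Lemma prism_fst_shuffle u :
  realization_map prism_fst_simplicial (shuffle u) = u.1.
Proof. by apply: realization_inj => p; exact: shuffle_proj. Qed.

Lemma shuffle_continuous :
  {within [set: realization R X] `*` `[0, 1], continuous shuffle}.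
Proof.
apply: continuous_on_cells_times_itv => s x t Xs sx tI.
have cell_dbl (u : realization R X * R) :
    closed_cell s u.1 -> closed_cell (dbl s) (shuffle u).
  rewrite /closed_cell /= => /fsubsetP su; apply/fsubsetP => -[p b].
  by move=> /(fsubsetP (shuffle_supp u)); rewrite !in_dbl; exact: su.
pose F := filter_prod (cell_nbhs s x) (within `[0, 1]%classic (nbhs t)).
change (shuffle u @[u --> F] --> shuffle (x, t)).
have near1 : \forall u \near F, closed_cell s (u.1 : realization R X).
  exists (closed_cell s, setT) => /=; last by move=> [y r] /= [].
  by split; [exact: near_cell|exact: filterT].
apply: (@cvg_realization _ _ _ _ _ _ (dbl s)).
- exact: cell_dbl.
- by apply: filterS near1 => u; exact: cell_dbl.
move=> [p b] _.
have -> : val (shuffle (x, t)) (p, b) = shuffle_fun (x, t) (p, b) by [].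
rewrite shuffle_funE.
(* Summing over [s] instead of the support removes the dependence of the index set on [y]. *)
have SE (y : realization R X) : closed_cell s y ->
    S y p = \sum_(q <- s | (q < p)%O) val y q.
  move=> sy; rewrite /S !(big_mkcond (fun q => (q < p)%O)).
  apply: big_fset_incl => // q _; rewrite mem_finsupp negbK => /eqP->.
  by case: ifP.
have cX q : val (u.1 : realization R X) q @[u --> F] --> val x q.
  apply: (@cvg_comp _ _ _ fst (fun y : realization R X => val y q) F
    (cell_nbhs s x)); [exact: cvg_fst|exact: cvg_coord].
have cS : S (u.1 : realization R X) p @[u --> F] --> S x p.
  rewrite SE //; apply: (@cvg_trans _
    (\sum_(q <- s | (q < p)%O) val (u.1 : realization R X) q @[u --> F])).
    by apply: near_eq_cvg; apply: filterS near1 => u /SE.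
  by apply: (cvg_big (op := +%R)) => [|q _]; [exact: add_continuous|exact: cX].
have cT : 1 - (u.2 : R) @[u --> F] --> 1 - t.
  apply: cvgB; first exact: cvg_cst.
  by apply: cvg_trans cvg_snd _; exact: cvg_within.
have cL : low (u.1 : realization R X) u.2 p @[u --> F] --> low x t p.
  apply: cvgB; apply: cvg_minr => //.
  by apply: cvgD => //; exact: cX.
apply: (@cvg_trans _ ((if b then val (u.1 : realization R X) p - low u.1 u.2 p
    else low u.1 u.2 p) @[u --> F])).
  apply: near_eq_cvg; apply: nearW => -[y r].
  have -> : val (shuffle (y, r)) (p, b) = shuffle_fun (y, r) (p, b) by [].
  by rewrite shuffle_funE.
by case: b; [apply: cvgB => //; exact: cX|].
Qed.

End Prism.

(** * Homotopies constructed on the prism *)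

Section PrismHomotopy.
Variables (R : realType) (d : Order.disp_t) (P : porderType d).
Variables (X : scomplex P) (X_chain : forall s, X s -> chain s).
Variables (W : choiceType) (Y : scomplex W).

Lemma prism_homotopy (f g : realization R X -> realization R Y)
    (G : realization R (prism X) -> realization R Y) :
  continuous G ->
  (forall x, G (shuffle X_chain (x, 0)) = f x) ->
  (forall x, G (shuffle X_chain (x, 1)) = g x) ->
  homotopic R f g.
Proof.
move=> Gc G0 G1; exists (G \o shuffle X_chain); split=> //.
apply: homotopicP => x t It.
have /subspace_continuousP sc := @shuffle_continuous R _ _ X X_chain.
exact: cvg_comp (sc (x, t) (conj I It)) (Gc _).
Qed.

Section Simplicial.
Variables (f g : P -> W) (fX : simplicial X Y f) (gX : simplicial X Y g).

Let h (u : P * bool) := if u.2 then g u.1 else f u.1.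

(** The map [h] is [f] on the bottom of the prism and [g] on the top, and [shuffle] at times 0 and 1
    runs through these two copies of [X]. *)
Lemma contiguous_homotopic : simplicial (prism X) Y h ->
  homotopic R (@realization_map R _ _ _ _ _ fX)
              (@realization_map R _ _ _ _ _ gX).
Proof.
move=> hX; apply: (@prism_homotopy _ _ (@realization_map R _ _ _ _ _ hX)).
- exact: realization_map_continuous.
- move=> x; apply: realization_inj => w.
  rewrite -[LHS]/(Defs.pushforward h (val (shuffle X_chain (x, 0))) w).
  rewrite -[RHS]/(Defs.pushforward f (val x) w).
  set z := val (shuffle _ _).
  have zx : (finsupp z `<=` (finsupp (val x) `*` [fset true; false]))%fset.
    apply/fsubsetP => -[p b]; rewrite mem_finsupp shuffle0 in_fsetM !inE.
    by case: b; rewrite ?eqxx //= andbT -mem_finsupp.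
  rewrite (pushforward_sup _ _ zx) sum_fset_boolX pushforwardE.
  rewrite [RHS]big_mkcond; apply: eq_bigr => p _.
  by rewrite !shuffle0 /h /=; case: ifP; rewrite add0r.
- move=> x; apply: realization_inj => w.
  rewrite -[LHS]/(Defs.pushforward h (val (shuffle X_chain (x, 1))) w).
  rewrite -[RHS]/(Defs.pushforward g (val x) w).
  set z := val (shuffle _ _).
  have zx : (finsupp z `<=` (finsupp (val x) `*` [fset true; false]))%fset.
    apply/fsubsetP => -[p b]; rewrite mem_finsupp shuffle1 in_fsetM !inE.
    by case: b; rewrite ?eqxx //= andbT -mem_finsupp.
  rewrite (pushforward_sup _ _ zx) sum_fset_boolX pushforwardE.
  rewrite [RHS]big_mkcond; apply: eq_bigr => p _.
  by rewrite !shuffle1 /h /=; case: (f p == w); rewrite addr0.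
Qed.

End Simplicial.

Section Carried.
Variable C : {fset P} -> scomplex W.
Hypothesis C_mono : forall s t, X s -> t != fset0 -> (t `<=` s)%fset ->
  simplex (C t) `<=` simplex (C s).
Hypothesis CY : forall s, X s -> simplex (C s) `<=` simplex Y.
Hypothesis C_contr : forall s, X s -> contractible R (realization R (C s)).
Variables f g : realization R X -> realization R Y.
Hypotheses (fc : continuous f) (gc : continuous g).
Hypothesis fC : forall x, C (finsupp (val x)) (finsupp (val (f x))).
Hypothesis gC : forall x, C (finsupp (val x)) (finsupp (val (g x))).

(** The maps [f] and [g] prescribe a map on the two ends of the prism; it extends over the prism
    along the carrier pulled back by the projection to [X]. *)
Lemma carried_homotopic : homotopic R f g.
Proof.
pose C' (s : {fset P * bool}) := C (fst @` s)%fset.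
(* The two ends: simplices with constant second coordinate. *)
pose A : set {fset P * bool} :=
  [set s | prism X s /\ exists b, forall v, v \in s -> v.2 = b].
have Ad s t : A s -> t != fset0 -> (t `<=` s)%fset -> A t.
  move=> [Xs [b sb]] t0 ts; split; first exact: simplex_sub ts t0.
  by exists b => v /(fsubsetP ts)/sb.
pose pr := @realization_map R _ _ _ _ _ (@prism_fst_simplicial _ _ X).
have prc : continuous pr by exact: realization_map_continuous.
have prE z : finsupp (val (pr z)) = (fst @` finsupp (val z))%fset.
  by rewrite /= finsupp_pushforward // => v; exact: coord_ge0.
pose g0 (z : realization R (prism X)) :=
  if `[< forall v, v \in finsupp (val z) -> v.2 = false >] then f (pr z)
  else g (pr z).
have g0f z : (forall v, v \in finsupp (val z) -> v.2 = false) ->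
    g0 z = f (pr z).
  by move=> /asboolP zf; rewrite /g0 zf.
have g0g z : (forall v, v \in finsupp (val z) -> v.2 = true) ->
    g0 z = g (pr z).
  move=> zt; rewrite /g0; case: asboolP => // zf.
  have /fset0Pn[v vz] := simplex_neq0 (supp_simplex z).
  by have := zt v vz; rewrite zf.
have [||||||G [Gc GA _]] := @carrier_extension R _ _ (prism X) Y C' _ _ _ A g0.
- move=> s t [Xs _] t0 ts; apply: C_mono => //.
    have /fset0Pn[u ut] := t0; apply/fset0Pn; exists u.1.
    by apply/imfsetP; exists u.
  by apply: subset_imfset; exact/fsubsetP.
- by move=> s [Xs _]; exact: CY.
- by move=> s [Xs _]; exact: C_contr.
- exact: Ad.
- move=> s z [Xs [b sb]] sz.
  (* A cell of [A] lies in a single end, where [g0] is one of the continuous maps [f] and [g] after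
     the projection. *)
  suff [k [kc kE]] : exists k : realization R X -> realization R Y,
      continuous k /\ forall y, closed_cell s y -> g0 y = k (pr y).
    rewrite kE //; apply: (@cvg_trans _ ((k \o pr) @ cell_nbhs s z)).
      by apply: near_eq_cvg; apply: filterS (near_cell s z) => y /kE ->.
    have cpr : pr @ cell_nbhs s z --> pr z.
      apply: cvg_trans (prc z).
      by apply: cvg_app; exact: cell_nbhs_cvg.
    exact: cvg_comp cpr (kc _).
  case: b sb => sb; [exists g|exists f]; split=> // y /fsubsetP sy.
    by apply: g0g => v /sy/sb.
  by apply: g0f => v /sy/sb.
- by move=> z _; rewrite /C' -prE /g0; case: ifP.
have prs u : pr (shuffle X_chain u) = u.1 by exact: prism_fst_shuffle.
apply: (prism_homotopy Gc) => x.
  have sf v : v \in finsupp (val (shuffle X_chain (x, 0))) -> v.2 = false.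
    by case: v => p []; rewrite mem_finsupp shuffle0 ?eqxx.
  rewrite GA ?g0f ?prs //; split; first exact: supp_simplex.
  by exists false.
have sf v : v \in finsupp (val (shuffle X_chain (x, 1))) -> v.2 = true.
  by case: v => p []; rewrite mem_finsupp shuffle1 ?eqxx.
rewrite GA ?g0g ?prs //; split; first exact: supp_simplex.
by exists true.
Qed.

End Carried.

End PrismHomotopy.

(** * Quillen's fibre lemma *)

(** A general relation lets the order and its reverse give both extremal elements of a chain. *)
Lemma total_extremum (T : choiceType) (r : rel T) (s : {fset T}) :
  reflexive r -> transitive r -> s != fset0 ->
  {in s &, forall x y, r x y || r y x} ->
  exists2 m, m \in s & forall x, x \in s -> r m x.
Proof.
move=> rxx rtr s0 rs.
have H (l : seq T) : {subset l <= s} -> l != [::] ->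
    exists2 m, m \in l & forall x, x \in l -> r m x.
  elim: l => // x l IH ls _.
  have [->|l0] := eqVneq l [::].
    by exists x; rewrite ?mem_head // => y; rewrite inE => /eqP->.
  have ls' : {subset l <= s} by move=> y yl; apply: ls; rewrite inE yl orbT.
  have [m ml mP] := IH ls' l0.
  have /orP[mx|xm] := rs m x (ls' m ml) (ls x (mem_head x l)).
    exists m; first by rewrite inE ml orbT.
    by move=> y; rewrite inE => /orP[/eqP->|/mP].
  exists x; rewrite ?mem_head // => y; rewrite inE => /orP[/eqP->//|/mP].
  exact: rtr.
exact: (H (enum_fset s)).
Qed.

(** * Finite chains and full subcomplexes of the order complex *)

Section Chains.
Variables (d : Order.disp_t) (P : porderType d).

Lemma chain_min (s : {fset P}) : s != fset0 -> chain s ->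
  exists2 m, m \in s & forall p, p \in s -> (m <= p)%O.
Proof. by move=> s0 cs; apply: total_extremum => //; exact: le_trans. Qed.

Lemma chain_max (s : {fset P}) : s != fset0 -> chain s ->
  exists2 m, m \in s & forall p, p \in s -> (p <= m)%O.
Proof.
move=> s0 cs; apply: (@total_extremum P (fun p q => (q <= p)%O)) => //.
  by move=> y x z xy yz; exact: le_trans yz xy.
by move=> x y xs ys; rewrite orbC; exact: cs.
Qed.

(** The order complex of [D], kept on the vertex type [P] rather than on a subtype, so that it is
    literally a subcomplex and can be the value of a carrier. *)
Definition subchain (D : set P) : set {fset P} :=
  [set s | [/\ s != fset0, forall p, p \in s -> D p & chain s]].

Lemma subchain_neq0 D s : subchain D s -> s != fset0.
Proof. by case. Qed.

Lemma subchain_sub D s t : subchain D s -> (t `<=` s)%fset -> t != fset0 ->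
  subchain D t.
Proof.
move=> [_ sD cs] /fsubsetP ts t0; split=> // [p /ts/sD //|p q /ts ps /ts qs].
exact: cs.
Qed.

Definition order_subcomplex (D : set P) : scomplex P :=
  SComplex (@subchain_neq0 D) (@subchain_sub D).

Lemma order_subcomplex_chain D s : order_subcomplex D s -> chain s.
Proof. by case. Qed.

Lemma order_subcomplexS (D E : set P) : D `<=` E ->
  simplex (order_subcomplex D) `<=` simplex (order_subcomplex E).
Proof. by move=> DE s [s0 sD cs]; split=> // p /sD/DE. Qed.

Lemma order_subcomplex_order_complex D :
  simplex (order_subcomplex D) `<=` simplex (order_complex P).
Proof. by move=> s []. Qed.

End Chains.

(** * Monotone maps between subsets of posets *)

Section PosetMaps.
Variables (R : realType) (d d' : Order.disp_t).
Variables (P : porderType d) (Q : porderType d') (D : set P) (E : set Q).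

(** The function is total but constrained on [D] only, which accommodates functions obtained by
    choice with junk values elsewhere. *)
Definition mono_on (f : P -> Q) :=
  (forall p, D p -> E (f p)) /\
  (forall p q, D p -> D q -> (p <= q)%O -> (f p <= f q)%O).

Lemma mono_on_simplicial f : mono_on f ->
  simplicial (order_subcomplex D) (order_subcomplex E) f.
Proof.
move=> [fE fm] s [s0 sD cs]; split.
- have /fset0Pn[p ps] := s0; apply/fset0Pn; exists (f p).
  by apply/imfsetP; exists p.
- by move=> _ /imfsetP[p /= /sD/fE ? ->].
- move=> _ _ /imfsetP[p /= ps ->] /imfsetP[q /= qs ->].
  have /orP[pq|qp] := cs p q ps qs; apply/orP; [left|right]; apply: fm => //;
    exact: sD.
Qed.

(** A bottom vertex [q] and a top vertex [p] of one prism simplex satisfy [q <= p], so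
    [f q <= g q <= g p]: images of prism simplices are chains. *)
Lemma le_homotopic f g (fm : mono_on f) (gm : mono_on g) :
  (forall p, D p -> (f p <= g p)%O) ->
  homotopic R (@realization_map R _ _ _ _ _ (mono_on_simplicial fm))
              (@realization_map R _ _ _ _ _ (mono_on_simplicial gm)).
Proof.
move=> fg; apply: contiguous_homotopic; first exact: order_subcomplex_chain.
move=> s [[s0 sD cs] sp].
have sD' u : u \in s -> D u.1.
  by move=> us; apply: sD; apply/imfsetP; exists u.
have [fE fmm] := fm; have [gE gmm] := gm; split.
- have /fset0Pn[_ /imfsetP[u /= us _]] := s0; apply/fset0Pn.
  by eexists; apply/imfsetP; exists u.
- move=> _ /imfsetP[u /= us ->]; case: ifP => _; [apply: gE|apply: fE];
    exact: sD'.
- have c u v : u \in s -> v \in s -> (u.1 >=< v.1)%O.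
    by move=> us vs; apply: cs; apply/imfsetP; [exists u|exists v].
  move=> _ _ /imfsetP[[p b] /= us ->] /imfsetP[[q b'] /= vs ->].
  have Dp := sD' _ us; have Dq := sD' _ vs; rewrite /= in Dp Dq.
  case: b b' us vs => [] [] /= us vs.
  + by have /orP[pq|qp] := c _ _ us vs; apply/orP; [left|right]; exact: gmm.
  + apply/orP; right; apply: le_trans (fg _ Dq) _.
    by apply: gmm => //; exact: sp.
  + apply/orP; left; apply: le_trans (fg _ Dp) _.
    by apply: gmm => //; exact: sp.
  + by have /orP[pq|qp] := c _ _ us vs; apply/orP; [left|right]; exact: fmm.
Qed.

End PosetMaps.

Section Vertex.
Variables (R : realType) (V : choiceType) (K : scomplex V) (c : V).
Hypothesis Kc : K [fset c]%fset.

Definition vertex_fun : {fsfun V -> R with 0} :=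
  [fsfun v in [fset c]%fset => 1 | 0].

Lemma vertex_funE v : vertex_fun v = (v == c)%:R.
Proof. by rewrite fsfunE inE; case: eqP. Qed.

Lemma vertex_subproof : vertex_fun \in realization_set R K.
Proof.
have supp : finsupp vertex_fun = [fset c]%fset.
  apply/fsetP => v; rewrite mem_finsupp vertex_funE inE.
  by case: (v == c); rewrite ?oner_eq0 ?eqxx.
apply/mem_set; apply: (@realization_setI _ _ _ _ [fset c]%fset).
- by move=> v; rewrite vertex_funE ler0n.
- by rewrite supp fsubset_refl.
- by rewrite big_seq_fset1 vertex_funE eqxx.
- by move=> t t0; rewrite supp => ts; exact: simplex_sub Kc ts t0.
Qed.

Definition vertex : realization R K := exist _ vertex_fun vertex_subproof.

End Vertex.

(** * Contractibility criteria for posets *)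

Section ContractiblePosets.
Variables (R : realType) (d : Order.disp_t) (P : porderType d) (D : set P).

Let Y := order_subcomplex D.

Lemma realization_map_id_on (f : P -> P) (fY : simplicial Y Y f) :
  (forall p, D p -> f p = p) -> @realization_map R _ _ _ _ _ fY = id.
Proof.
move=> fE; apply/funext => x; apply: realization_inj => w.
rewrite -[LHS]/(Defs.pushforward f (val x) w) pushforwardE.
have [_ xD _] := supp_simplex x.
rewrite big_seq_cond.
rewrite (eq_bigl (fun v => (v \in finsupp (val x)) && (v == w))); last first.
  by move=> v; case vx: (v \in _) => //=; rewrite fE //; exact: xD.
rewrite -big_seq_cond big_mkcond.
have [wx|wx] := boolP (w \in finsupp (val x)).
  rewrite (big_fsetD1 w) //= eqxx big1_seq ?addr0 // => v.
  by rewrite !inE => /andP[_ /andP[/negPf->]].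
rewrite (fsfun_dflt wx) big1_seq // => v /andP[_ vx].
by case: eqP => // vw; rewrite -vw vx in wx.
Qed.

Lemma realization_map_const_on (f : P -> P) (fY : simplicial Y Y f) c
    (Yc : Y [fset c]%fset) :
  (forall p, D p -> f p = c) ->
  @realization_map R _ _ _ _ _ fY = fun=> vertex R Yc.
Proof.
move=> fE; apply/funext => x; apply: realization_inj => w.
rewrite -[LHS]/(Defs.pushforward f (val x) w) pushforwardE.
rewrite -[RHS]/(vertex_fun R c w) vertex_funE.
have [_ xD _] := supp_simplex x; rewrite big_mkcond big_seq.
case: eqP => [->|/eqP wc]; last first.
  by rewrite big1 // => v /xD/fE ->; rewrite eq_sym (negPf wc).
rewrite -(sum_coord (fsubset_refl _ : closed_cell _ x)) [RHS]big_seq.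
by apply: eq_bigr => v /xD/fE ->; rewrite eqxx.
Qed.

Lemma vertex_order_subcomplex c : D c -> Y [fset c]%fset.
Proof.
move=> Dc; split; first by apply/fset0Pn; exists c; rewrite inE.
  by move=> p; rewrite inE => /eqP->.
by move=> p q; rewrite !inE => /eqP-> /eqP->; rewrite comparablexx.
Qed.

Lemma mono_on_id : mono_on D D id. Proof. by []. Qed.

Lemma mono_on_cst c : D c -> mono_on D D (fun=> c : P).
Proof. by move=> Dc; split. Qed.

Let id_mapE :
  @realization_map R _ _ Y Y _ (mono_on_simplicial mono_on_id) = id.
Proof. exact: realization_map_id_on. Qed.

Let cst_mapE c (Dc : D c) :
  @realization_map R _ _ Y Y _ (mono_on_simplicial (mono_on_cst Dc)) =
  fun=> vertex R (vertex_order_subcomplex Dc).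
Proof. exact: realization_map_const_on. Qed.

Lemma least_contractible c : D c -> (forall p, D p -> (c <= p)%O) ->
  contractible R (realization R Y).
Proof.
move=> Dc cP; exists (vertex R (vertex_order_subcomplex Dc)).
have := @le_homotopic R _ _ _ _ _ _ _ _ (mono_on_cst Dc) mono_on_id cP.
by rewrite cst_mapE id_mapE; exact: homotopic_sym.
Qed.

Lemma greatest_contractible c : D c -> (forall p, D p -> (p <= c)%O) ->
  contractible R (realization R Y).
Proof.
move=> Dc cP; exists (vertex R (vertex_order_subcomplex Dc)).
have := @le_homotopic R _ _ _ _ _ _ _ _ mono_on_id (mono_on_cst Dc) cP.
by rewrite cst_mapE id_mapE.
Qed.

(** The comparisons [id >= a <= b >= c] give three homotopies, joining the identity to a constant
    map. *)
Lemma zigzag_contractible (a b : P -> P) c :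
  mono_on D D a -> mono_on D D b -> D c ->
  (forall p, D p -> [/\ a p <= p, a p <= b p & c <= b p]%O) ->
  contractible R (realization R Y).
Proof.
move=> am bm Dc abc; exists (vertex R (vertex_order_subcomplex Dc)).
have h1 := @le_homotopic R _ _ _ _ _ _ _ _ am mono_on_id
  (fun p Dp => let: And3 h _ _ := abc p Dp in h).
have h2 := @le_homotopic R _ _ _ _ _ _ _ _ am bm
  (fun p Dp => let: And3 _ h _ := abc p Dp in h).
have h3 := @le_homotopic R _ _ _ _ _ _ _ _ (mono_on_cst Dc) bm
  (fun p Dp => let: And3 _ _ h := abc p Dp in h).
rewrite id_mapE in h1; rewrite cst_mapE in h3.
apply: homotopic_trans (homotopic_sym h3).
exact: homotopic_trans (homotopic_sym h1) h2.
Qed.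

End ContractiblePosets.

Section QuillenFibre.
Variables (R : realType) (d d' : Order.disp_t).
Variables (P : porderType d) (Q : porderType d') (f : P -> Q).
Variable hf : {homo f : x y / (x <= y)%O}.

Lemma quillen_fibre :
  (forall q, contractible R
    (realization R (order_subcomplex [set p | (q <= f p)%O]))) ->
  homotopy_equivalence R (order_realization_map R f hf).
Proof.
move=> fibre.
pose F := order_realization_map R f hf.
have Fc : continuous F by exact: realization_map_continuous.
have FE x : finsupp (val (F x)) = (f @` finsupp (val x))%fset.
  by rewrite /= finsupp_pushforward // => v; exact: coord_ge0.
(* Written as a union of fibres, [U] is visibly monotone in [c]; on a chain it is the single fibre
   over the least element. *)
pose U (c : {fset Q}) : set P := [set p | exists2 q, q \in c & (q <= f p)%O].
have U_mono (s t : {fset Q}) : (t `<=` s)%fset -> U t `<=` U s.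
  by move=> /fsubsetP ts p [q /ts qs qp]; exists q.
have U_contr (c : {fset Q}) : order_complex Q c ->
    contractible R (realization R (order_subcomplex (U c))).
  move=> [c0 cc]; have [m mc mP] := chain_min c0 cc.
  suff -> : U c = [set p | (m <= f p)%O] by exact: fibre.
  apply/seteqP; split=> [p [q /mP mq qp]|p mp]; first exact: le_trans mq qp.
  by exists m.
split=> //.
have [|||g [gc gU]] := @carrier_map R _ _ (order_complex Q) (order_complex P)
    (fun c => order_subcomplex (U c)).
- by move=> s t _ _ ts; apply: order_subcomplexS; exact: U_mono.
- by move=> s _; exact: order_subcomplex_order_complex.
- by move=> s; exact: U_contr.
exists g; split=> //.
(* Both [g \o F] and the identity are carried by the sets [U] of the images under [f]. *)
- apply: (@carried_homotopic R _ _ (order_complex P) _ _ (order_complex P)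
      (fun c => order_subcomplex (U (f @` c)%fset))).
  + by move=> s [].
  + move=> s t _ _ /fsubsetP ts; apply: order_subcomplexS; apply: U_mono.
    by apply: subset_imfset => p; exact: ts.
  + by move=> s _; exact: order_subcomplex_order_complex.
  + move=> s Ps; apply: U_contr; exact: (nondecreasing_simplicial hf).
  + by move=> x; apply: continuous_comp; [exact: Fc|exact: gc].
  + by move=> x; exact: cvg_id.
  + by move=> x; rewrite -FE; exact: gU.
  + move=> x /=; have [x0 xc] := supp_simplex x; split=> // p px.
    by exists (f p) => //; apply/imfsetP; exists p.
(* Both [F \o g] and the identity are carried by the up-set of a chain, which is a cone on the least
   element of the chain. *)
- pose C (c : {fset Q}) : set Q := [set p | exists2 q, q \in c & (q <= p)%O].
  apply: (@carried_homotopic R _ _ (order_complex Q) _ _ (order_complex Q)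
      (fun c => order_subcomplex (C c))).
  + by move=> s [].
  + move=> s t _ _ /fsubsetP ts; apply: order_subcomplexS.
    by move=> p [q /ts qs qp]; exists q.
  + by move=> s _; exact: order_subcomplex_order_complex.
  + move=> c [c0 cc]; have [m mc mP] := chain_min c0 cc.
    apply: (@least_contractible _ _ _ _ m); first by exists m.
    by move=> p [q /mP mq qp]; exact: le_trans mq qp.
  + by move=> x; apply: continuous_comp; [exact: gc|exact: Fc].
  + by move=> x; exact: cvg_id.
  + move=> x; have [gx0 gxU _] := gU x.
    have [Fx0 Fxc] := supp_simplex (F (g x)); split=> // q.
    rewrite [finsupp _](FE (g x)) => /imfsetP[p /= /gxU[q' q'x q'p] ->].
    by exists q'.
  + move=> x /=; have [x0 xc] := supp_simplex x; split=> // p px.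
    by exists p.
Qed.

End QuillenFibre.

(** * The covering relation *)

Section CoveringFibres.
Variables (R : realType) (V : choiceType) (K : scomplex V).
Variables (U : set (scomplex V)) (hU : good_cover R K U).
Implicit Types (x y : covering_poset K U) (T : {fset scomplex V}).

Lemma covering_leE x y : (x <= y)%O =
  (val (covering_fst x) `<=` val (covering_fst y))%fset &&
  (val (covering_snd x) `<=` val (covering_snd y))%fset.
Proof. by []. Qed.

Lemma covering_mem x L : L \in val (covering_snd x) -> L (val (covering_fst x)).
Proof. by have /set_mem := valP x; apply. Qed.

Lemma face_posetP (W : choiceType) (M : scomplex W) (s : face_poset M) :
  M (val s).
Proof. exact: set_mem (valP s). Qed.

(** The simplex [s] itself witnesses that the members of [T] intersect, so [T] is a simplex of the
    nerve. *)
Lemma covering_ex (s : face_poset K) T : T != fset0 ->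
  (forall L, L \in T -> U L /\ L (val s)) ->
  exists x, covering_fst x = s /\ val (covering_snd x) = T.
Proof.
move=> T0 TU; have NT : nerve U T.
  split=> //; first by move=> L /TU[].
  exists (val s); split; first exact: simplex_neq0 (face_posetP s).
  by move=> L /TU[].
pose t : face_poset (nerve U) := exist _ T (mem_set NT).
have st : (s, t) \in covering_relation K U by apply/mem_set => L /TU[].
by exists (exist _ (s, t) st).
Qed.

Lemma covering_fst_fibre (s : face_poset K) : contractible R
  (realization R (order_subcomplex
    [set x : covering_poset K U | (s <= covering_fst x)%O])).
Proof.
have [[_ cov] _] := hU; have [U0 UU0 sU0] := cov _ (face_posetP s).
have Usnd x L : L \in val (covering_snd x) -> U L.
  by have [_ + _] := face_posetP (covering_snd x); exact.
have face x L : (s <= covering_fst x)%O -> L \in val (covering_snd x) ->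
    L (val s).
  move=> sx /covering_mem Lx; apply: simplex_sub Lx sx _.
  exact: simplex_neq0 (face_posetP s).
have snd0 x : val (covering_snd x) != fset0.
  exact: simplex_neq0 (face_posetP (covering_snd x)).
(* On the fibre, [a] shrinks the first component to its face [s], which stays in the same cover
   elements; elsewhere [a] is arbitrary. *)
have /choice[a aP] x : exists y, (s <= covering_fst x)%O ->
    covering_fst y = s /\ val (covering_snd y) = val (covering_snd x).
  have [sx|nsx] := pselect (s <= covering_fst x)%O; last by exists x.
  have [||y yP] := @covering_ex s (val (covering_snd x)); [exact: snd0| |].
    by move=> L Lx; split; [exact: Usnd Lx|exact: face Lx].
  by exists y.
have /choice[b bP] x : exists y, (s <= covering_fst x)%O ->
    covering_fst y = s /\
    val (covering_snd y) = (U0 |` val (covering_snd x))%fset.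
  have [sx|nsx] := pselect (s <= covering_fst x)%O; last by exists x.
  have [||y yP] := @covering_ex s (U0 |` val (covering_snd x))%fset.
  - by apply/fset0Pn; exists U0; rewrite !inE eqxx.
  - move=> L; rewrite !inE => /orP[/eqP->//|Lx].
    by split; [exact: Usnd Lx|exact: face Lx].
  by exists y.
have [||c [c1 c2]] := @covering_ex s [fset U0]%fset.
- by apply/fset0Pn; exists U0; exact: fset11.
- by move=> L /fset1P ->.
apply: (@zigzag_contractible R _ _ _ a b c).
- split=> [x /= /aP[-> _] //|x y /= sx sy].
  rewrite !covering_leE; have [-> ->] := aP _ sx; have [-> ->] := aP _ sy.
  by rewrite fsubset_refl => /andP[_ ->].
- split=> [x /= /bP[-> _] //|x y /= sx sy].
  rewrite !covering_leE; have [-> ->] := bP _ sx; have [-> ->] := bP _ sy.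
  by rewrite fsubset_refl => /andP[_ xy]; exact: fsetUS.
- by rewrite /= c1.
- move=> x sx; rewrite !covering_leE c1 c2.
  have [-> ->] := aP _ sx; have [-> ->] := bP _ sx.
  rewrite !fsubset_refl /= andbT.
  by split; [exact: sx|exact: fsubsetUr|exact: fsubsetUl].
Qed.

Lemma covering_snd_fibre (t : face_poset (nerve U)) : contractible R
  (realization R (order_subcomplex
    [set x : covering_poset K U | (t <= covering_snd x)%O])).
Proof.
have [[UK _] good] := hU.
set D := [set x : covering_poset K U | (t <= covering_snd x)%O].
have [t0 tU tne] := face_posetP t.
pose L := inter_complex (val t).
have cL : contractible R (realization R L) by exact: good.
have LK s : L s -> K s.
  move=> [_ Ls]; have /fset0Pn[M Mt] := t0.
  by apply: UK (tU _ Mt) _ _; exact: Ls.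
have LD x : D x -> L (val (covering_fst x)).
  move=> Dx; split; first exact: simplex_neq0 (face_posetP (covering_fst x)).
  by move=> M /(fsubsetP Dx); exact: covering_mem.
have /choice[v vP] x : exists v, v \in val (covering_fst x).
  exact/fset0Pn/(simplex_neq0 (face_posetP (covering_fst x))).
have v_sub (c : {fset covering_poset K U}) m :
    (forall x, x \in c -> (x <= m)%O) ->
    (v @` c `<=` val (covering_fst m))%fset.
  move=> cm; apply/fsubsetP => _ /imfsetP[x /= /cm + ->].
  by rewrite covering_leE => /andP[/fsubsetP xm _]; exact/xm/vP.
(* The vertices chosen along a chain all lie in the first component of its largest element, which is
   a simplex of [L]. *)
have vL : simplicial (order_subcomplex D) L v.
  move=> c [c0 cD cc]; have [m mc mP] := chain_max c0 cc.
  apply: simplex_sub (LD m (cD m mc)) (v_sub c m mP) _.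
  have /fset0Pn[x xc] := c0; apply/fset0Pn; exists (v x).
  by apply/imfsetP; exists x.
(* Fixing the second component at [t] gives [E s] the greatest element [(s, t)], hence a
   contractible realization. *)
pose E (s : {fset V}) := [set x : covering_poset K U |
  (val (covering_fst x) `<=` s)%fset /\ covering_snd x = t].
have [|||j [jc jE]] := @carrier_map R _ _ L (order_subcomplex D)
    (fun s => order_subcomplex (E s)).
- move=> s u _ _ us; apply: order_subcomplexS => x [xu xt]; split=> //.
  exact: fsubset_trans xu us.
- by move=> s _; apply: order_subcomplexS => x [_ xt]; rewrite /D /= xt.
- move=> s Ls; pose s' : face_poset K := exist _ s (mem_set (LK _ Ls)).
  have [|m [m1 m2]] := @covering_ex s' (val t) t0.
    by move=> M Mt; split; [exact: tU|exact: Ls.2].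
  apply: (@greatest_contractible _ _ _ _ m).
    by split; [rewrite m1 fsubset_refl|exact: val_inj].
  by move=> x [xs xt]; rewrite covering_leE m1 m2 xt fsubset_refl andbT.
pose r := @realization_map R _ _ _ _ _ vL.
have rc : continuous r by exact: realization_map_continuous.
have h1 : homotopic R (j \o r) id.
  (* The part of [D] below a chain [c] is a cone on the largest element of [c]. It carries [j \o r]:
     [r x] is supported in the first component of the largest element supporting [x], and the values
     of [j] have second component [t], the least one in [D]. *)
  pose B (c : {fset covering_poset K U}) :=
    [set x | D x /\ exists2 y, y \in c & (x <= y)%O].
  apply: (@carried_homotopic R _ _ (order_subcomplex D) _ _ (order_subcomplex D)
      (fun c => order_subcomplex (B c))).
  + by move=> s [].
  + move=> c c' _ _ /fsubsetP cc'; apply: order_subcomplexS.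
    by move=> x [Dx [y /cc' yc xy]]; split=> //; exists y.
  + by move=> c _; apply: order_subcomplexS => x [].
  + move=> c [c0 cD cc]; have [m mc mP] := chain_max c0 cc.
    apply: (@greatest_contractible _ _ _ _ m).
      by split; [exact: cD|exists m].
    by move=> x [_ [y /mP ym xy]]; exact: le_trans xy ym.
  + by move=> x; apply: continuous_comp; [exact: rc|exact: jc].
  + by move=> x; exact: cvg_id.
  + move=> x; have [y0 yE yc] := jE (r x); split=> // p /yE[pr pt].
    split; first by rewrite /D /= pt.
    have [x0 xD xc] := supp_simplex x; have [m mx mP] := chain_max x0 xc.
    exists m => //; rewrite covering_leE pt; apply/andP; split; last exact: xD.
    apply: fsubset_trans pr _; rewrite /= finsupp_pushforward; last first.
      by move=> ?; exact: coord_ge0.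
    exact: v_sub.
  + move=> x /=; have [x0 xD xc] := supp_simplex x; split=> // p px.
    by split; [exact: xD|exists p].
(* Domination by |L| suffices: a contraction of |L|, precomposed with [r] and followed by [j],
   contracts [j \o r], which is homotopic to the identity. *)
have [x0 h2] := cL; exists (j x0).
exact: homotopic_trans (homotopic_sym h1) (homotopic_comp rc jc h2).
Qed.

End CoveringFibres.

Theorem theorem3p28 (R : realType) (V : choiceType) (K : scomplex V)
    (U : set (scomplex V)) (hU : good_cover R K U) :
  homotopy_equivalence R
    (order_realization_map R (@covering_fst V K U) (@covering_fst_le V K U)) /\
  homotopy_equivalence R
    (order_realization_map R (@covering_snd V K U) (@covering_snd_le V K U)).
Proof.
split; apply: quillen_fibre.
- exact: covering_fst_fibre hU.
- exact: covering_snd_fibre hU.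
Qed.
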